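(* Let $s\ge1$ be an integer and let $r=2s-2$. There is a constant $c(r)>0$, depending only on $r$, such that for each $n\ge1$ there exist a collection $Y_s$ and a function $F\in C^r\cap\Delta^{(1)}(Y_s)$ such that $$E_n^{(1)}(F,Y_s)>\sqrt n\,\frac{c(r)}{n^r}\,\omega_3\left(F^{(r)},\frac1n\right).$$ Hence, for every $A>0$ and $N>0$, there exist $n>N$, a collection $Y_s$ and a function $F\in C^r\cap\Delta^{(1)}(Y_s)$ such that $$E_n^{(1)}(F,Y_s)>\frac A{n^r}\,\omega_3\left(F^{(r)},\frac1n\right).$$
   Context: $C=C^0$ is the space of $2\pi$-periodic continuous functions $f:\mathbb R\to\mathbb R$ with the norm $\|f\|=\max_{x\in\mathbb R}|f(x)|$; for $r\in\mathbb N$, $C^r$ is the subspace of $r$ times continuously differentiable functions in $C$. A collection $Y_s=\{y_i\}_{i\in\mathbb Z}$, $s\in\mathbb N$, consists of real points with $y_i<y_{i+1}$ and $y_{i+2s}=y_i+2\pi$ for all $i\in\mathbb Z$. $\Delta^{(1)}(Y_s)$ is the set of $f\in C$ such that $(-1)^{i-1}f$ is nondecreasing on $[y_{i-1},y_i]$ for every $i\in\mathbb Z$. For $f\in\Delta^{(1)}(Y_s)$ and $n\ge1$, $E_n^{(1)}(f,Y_s)=\inf\|f-T_n\|$, the infimum being over all trigonometric polynomials $T_n$ of degree $<n$ that belong to $\Delta^{(1)}(Y_s)$. For $g\in C$ and $k\ge1$, $\omega_k(g,t)=\sup_{0<h\le t}\|\Delta_h^k(g,\cdot)\|$ is the $k$th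 modulus of smoothness, where $\Delta_h^k(g,x)=\sum_{i=0}^k(-1)^i\binom ki g(x+ih)$. *)

(* Defs.v *)
From Stdlib Require Import Reals ZArith Lra Lia.
From Coquelicot Require Import Coquelicot.
Open Scope R_scope.

(** The space [C = C^0] and its subspaces [C^r]. *)
Definition Cper (f : R -> R) : Prop :=
  (forall x, continuous f x) /\ (forall x, f (x + 2 * PI) = f x).

Definition Cr (r : nat) (f : R -> R) : Prop :=
  Cper f /\
  (forall k x, (k <= r)%nat -> ex_derive_n f k x) /\
  (forall x, continuous (Derive_n f r) x).

(** [Lub_Rbar] and [Glb_Rbar] are read back in [R] by [real], which sends
    infinities to [0]; [supnorm_max], [omega_lub] and [En1_glb] below show that
    this never happens in the situations of interest. *)
Definition supnorm (f : R -> R) : R :=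
  real (Lub_Rbar (fun z => exists x, z = Rabs (f x))).

(** [Binomial.C] is the real-valued binomial coefficient. *)
Definition fdiff (k : nat) (h : R) (g : R -> R) (x : R) : R :=
  sum_f_R0 (fun i => (-1) ^ i * Binomial.C k i * g (x + INR i * h)) k.

Definition omega (k : nat) (g : R -> R) (t : R) : R :=
  real (Lub_Rbar (fun z => exists h, 0 < h <= t /\ z = supnorm (fdiff k h g))).

Record collection (s : nat) := Collection {
  pt :> Z -> R;
  pt_incr : forall i : Z, pt i < pt (i + 1)%Z;
  pt_period : forall i : Z, pt (i + 2 * Z.of_nat s)%Z = pt i + 2 * PI
}.
Arguments pt {s} _ _.

Definition Delta1 {s : nat} (Y : collection s) (f : R -> R) : Prop :=
  Cper f /\
  forall (i : Z) (u v : R), Y (i - 1)%Z <= u -> u <= v -> v <= Y i ->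
    powerRZ (-1) (i - 1) * f u <= powerRZ (-1) (i - 1) * f v.

(** Trigonometric polynomials of degree [< n]. *)
Definition trigpoly (n : nat) (T : R -> R) : Prop :=
  exists (m : nat) (a b : nat -> R), (m < n)%nat /\
    forall x, T x =
      sum_f_R0 (fun k => a k * cos (INR k * x) + b k * sin (INR k * x)) m.

Definition En1 {s : nat} (n : nat) (f : R -> R) (Y : collection s) : R :=
  real (Glb_Rbar (fun e => exists T,
    trigpoly n T /\ Delta1 Y T /\ e = supnorm (fun x => f x - T x))).

Lemma Lub_real (E : R -> Prop) (M : R) :
  (exists z, E z) -> (forall z, E z -> z <= M) -> is_lub E (real (Lub_Rbar E)).
Proof.
intros [z Hz] HM.
destruct (Lub_Rbar_correct E) as [H1 H2].
destruct (Lub_Rbar E) as [l| |].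
- split; [exact H1|].
  intros b Hb. exact (H2 (Finite b) Hb).
- exfalso. exact (H2 (Finite M) HM).
- exfalso. exact (H1 z Hz).
Qed.

Lemma Cper_bounded (f : R -> R) : Cper f ->
  exists x0, forall x, Rabs (f x) <= Rabs (f x0).
Proof.
intros [Hc Hp].
assert (HPI := PI_RGT_0).
destruct (continuity_ab_maj (fun x => Rabs (f x)) 0 (2 * PI)) as [x0 [H0 _]].
- lra.
- intros c _. apply continuity_pt_filterlim.
  apply (continuous_comp f Rabs); [apply Hc|].
  apply continuous_Rabs.
- exists x0. intros x.
  assert (HpN : forall (k : nat) u, f (u + INR k * (2 * PI)) = f u).
  { induction k as [|k IH]; intros u.
    - f_equal. simpl. ring.
    - rewrite S_INR, <- (IH u), <- (Hp (u + INR k * (2 * PI))).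
      f_equal. ring. }
  assert (HpZ : forall (k : Z) u, f (u + IZR k * (2 * PI)) = f u).
  { intros k u. destruct (Z_le_gt_dec 0 k) as [Hk|Hk].
    - rewrite <- (Z2Nat.id k), <- INR_IZR_INZ by lia. apply HpN.
    - rewrite <- (HpN (Z.to_nat (- k)) (u + IZR k * (2 * PI))).
      f_equal. rewrite INR_IZR_INZ, Z2Nat.id, opp_IZR by lia. ring. }
  destruct (base_Int_part (x / (2 * PI))) as [Ha Hb].
  set (k := Int_part (x / (2 * PI))) in *.
  rewrite <- (HpZ (- k)%Z x). apply H0.
  rewrite opp_IZR.
  assert (Hx : x = x / (2 * PI) * (2 * PI)) by (field; lra).
  set (q := x / (2 * PI)) in *. rewrite Hx.
  split; nra.
Qed.

Lemma supnorm_max (f : R -> R) : Cper f ->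
  exists x0, supnorm f = Rabs (f x0) /\ forall x, Rabs (f x) <= supnorm f.
Proof.
intros Hf. destruct (Cper_bounded f Hf) as [x0 H0]. exists x0.
destruct (Lub_real (fun z => exists x, z = Rabs (f x)) (Rabs (f x0)))
  as [H1 H2].
- exists (Rabs (f x0)). now exists x0.
- intros z [x ->]. apply H0.
- fold (supnorm f) in H1, H2.
  split.
  + apply Rle_antisym.
    * apply H2. intros z [x ->]. apply H0.
    * apply H1. now exists x0.
  + intros x. apply H1. now exists x.
Qed.

Lemma Cper_sum (u : nat -> R -> R) (n : nat) : (forall i, Cper (u i)) ->
  Cper (fun x => sum_f_R0 (fun i => u i x) n).
Proof.
intros Hu. induction n as [|n [IHc IHp]]; simpl; [apply Hu|].
split.
- intros x. apply (continuous_plus (V := R_NormedModule)).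
  + apply IHc.
  + apply (Hu (S n)).
- intros x. rewrite IHp. now rewrite (proj2 (Hu (S n))).
Qed.

Lemma Cper_fdiff (k : nat) (h : R) (g : R -> R) : Cper g -> Cper (fdiff k h g).
Proof.
intros [Hc Hp].
apply (Cper_sum (fun i x => (-1) ^ i * Binomial.C k i * g (x + INR i * h))).
intros i. split.
- intros x. apply (continuous_mult (K := R_AbsRing)).
  + apply continuous_const.
  + apply (continuous_comp (fun y => y + INR i * h) g).
    * apply (continuous_plus (V := R_NormedModule)).
      apply continuous_id. apply continuous_const.
    * apply Hc.
- intros x. rewrite <- (Hp (x + INR i * h)). do 2 f_equal. ring.
Qed.

Lemma omega_lub (k : nat) (g : R -> R) (t : R) : Cper g -> 0 < t ->
  is_lub (fun z => exists h, 0 < h <= t /\ z = supnorm (fdiff k h g)) (omega k g t).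
Proof.
intros Hg Ht.
destruct (supnorm_max g Hg) as [_ [_ Hn]].
apply Lub_real with (sum_f_R0
  (fun i => Rabs ((-1) ^ i * Binomial.C k i) * supnorm g) k).
- exists (supnorm (fdiff k t g)). exists t. split; [lra|reflexivity].
- intros z [h [_ ->]].
  destruct (supnorm_max _ (Cper_fdiff k h g Hg)) as [x0 [-> _]].
  unfold fdiff. eapply Rle_trans; [apply Rsum_abs|].
  apply sum_Rle. intros i _. rewrite Rabs_mult.
  apply Rmult_le_compat_l; [apply Rabs_pos|apply Hn].
Qed.

Lemma Cper_Derive_n (r : nat) (f : R -> R) : Cr r f -> Cper (Derive_n f r).
Proof.
intros [[_ Hp] [_ Hc]]. split; [exact Hc|].
intros x. rewrite <- (Derive_n_comp_trans f r x (2 * PI)).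
apply Derive_n_ext. exact Hp.
Qed.

Lemma En1_glb (s n : nat) (f : R -> R) (Y : collection s) :
  (1 <= n)%nat -> Cper f ->
  (forall T, trigpoly n T -> Delta1 Y T ->
     En1 n f Y <= supnorm (fun x => f x - T x)) /\
  (forall b, (forall T, trigpoly n T -> Delta1 Y T ->
     b <= supnorm (fun x => f x - T x)) -> b <= En1 n f Y).
Proof.
intros Hn [Hc Hp]. unfold En1.
set (S := fun e => exists T, trigpoly n T /\ Delta1 Y T /\
                     e = supnorm (fun x => f x - T x)).
assert (HS : forall e, S e -> 0 <= e).
{ intros e [T [_ [[[HTc HTp] _] ->]]].
  destruct (supnorm_max (fun x => f x - T x)) as [x0 [-> _]].
  - split; intros x.
    + apply (continuous_minus (V := R_NormedModule)); [apply Hc|apply HTc].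
    + now rewrite Hp, HTp.
  - apply Rabs_pos. }
assert (H0 : S (supnorm (fun x => f x - 0))).
{ exists (fun _ => 0). repeat split.
  - exists 0%nat, (fun _ => 0), (fun _ => 0). split; [lia|].
    intros x. simpl. ring.
  - intros x. apply continuous_const.
  - intros; lra. }
destruct (Glb_Rbar_correct S) as [H1 H2].
destruct (Glb_Rbar S) as [l| |].
- split.
  + intros T HT HD. apply (H1 (supnorm (fun x => f x - T x))). now exists T.
  + intros b Hb. apply (H2 (Finite b)).
    intros e [T [HT [HD ->]]]. simpl. auto.
- exfalso. exact (H1 _ H0).
- exfalso. exact (H2 (Finite 0) HS).
Qed.

(* Main.v *)
Require Import Defs.
From Stdlib Require Import Reals ZArith Lra Lia ClassicalEpsilon.
From Coquelicot Require Import Coquelicot.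
Open Scope R_scope.

(** All but one of the [2s] points of the collection are squeezed into an
    interval [[a, 2a]] with [a] of order [n^(-3/2)]; the last one is [PI].
    The derivative of a comonotone trigonometric polynomial [T] vanishes at the
    [2s - 1] clustered points, so by Rolle the derivative of order [2s - 1] of
    [T] vanishes at some [xi] in [[a, 2a]] ([comonotone_trig_flat]).

    The function to be approximated is a modification of the trigonometric
    polynomial [Q x = - sin (x / 2) ^ (2 s)] of degree [s].  Its derivative of
    order [2s - 1] is [sin (x / 2)] times a function that is nonzero at [0],
    hence at least [c * a] on the cluster ([model_Derive_n_lower]).
    Bernstein's inequality applied to [Q - T], of degree at most [n + s], gives
    [c * a <= C * n ^ (2s - 1) * ||Q - T||], so every comonotone [T] of degree
    less than [n] satisfies [||Q - T|| >= (c / C) * a / n ^ (2s - 1)].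

    [Q] itself does not have the right monotonicity, since it decreases on
    [[0, PI]] without turning at the cluster points.  Let [F] be obtained
    from [Q] by flattening it to a constant where [|sin (x / 2)| <= a].  A
    constant is monotone in both senses, so [F] is comonotone with the
    collection however many points lie in [[a, 2a]].  The difference [F - Q] is
    [a ^ (2s)] times a fixed [C^r] function of [sin (x / 2) / a], so it is
    [O(a ^ (2s))], negligible against [a / n ^ (2s - 1)] because [n * a] is
    small, and its derivative of order [r = 2s - 2] is [O(a ^ 2) = O(n ^ (-3))]
    ([flattened_near_model]).  As [omega_3 (Q^(r), 1/n)] is also [O(n ^ (-3))],
    we get [omega_3 (F^(r), 1/n) = O(n ^ (-3))] while the error is at least a
    constant times [n ^ (-r) * n ^ (-5/2)]: the quotient contains the factor
    [sqrt n].

    The weak form of Bernstein's inequality, with constant [2], comes from the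
    representation of [T'] as an average of translates of [T] over equally
    spaced points ([trig_derive]). *)

(** * Averages over equally spaced points *)

Definition avg (M : nat) (f : R -> R) : R :=
  sum_f_R0 (fun q => f (2 * PI * INR q / INR (S M))) M / INR (S M).

Lemma avg_ext (M : nat) (f g : R -> R) :
  (forall t, f t = g t) -> avg M f = avg M g.
Proof.
intros H. unfold avg. f_equal. apply sum_eq. intros i _. apply H.
Qed.

Lemma avg_lin (M : nat) (a b : R) (f g : R -> R) :
  avg M (fun t => a * f t + b * g t) = a * avg M f + b * avg M g.
Proof.
unfold avg. rewrite sum_plus.
rewrite (sum_eq (fun l => a * f (2 * PI * INR l / INR (S M)))
  (fun l => f (2 * PI * INR l / INR (S M)) * a)) by (intros; ring).
rewrite (sum_eq (fun l => b * g (2 * PI * INR l / INR (S M)))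
  (fun l => g (2 * PI * INR l / INR (S M)) * b)) by (intros; ring).
rewrite <- !scal_sum. unfold Rdiv. ring.
Qed.

Lemma avg_sum (M m : nat) (f : nat -> R -> R) :
  avg M (fun t => sum_f_R0 (fun i => f i t) m) =
  sum_f_R0 (fun i => avg M (f i)) m.
Proof.
induction m as [|m IH]; simpl; [reflexivity|].
rewrite <- IH.
rewrite (avg_ext M _ (fun t => 1 * sum_f_R0 (fun i => f i t) m + 1 * f (S m) t))
  by (intros; ring).
rewrite avg_lin. ring.
Qed.

Lemma avg_abs_le (M : nat) (f g : R -> R) :
  (forall t, Rabs (f t) <= g t) -> Rabs (avg M f) <= avg M g.
Proof.
intros H. assert (HN := lt_0_INR (S M) (Nat.lt_0_succ M)).
unfold avg, Rdiv.
rewrite Rabs_mult, (Rabs_pos_eq (/ _)) by (apply Rlt_le, Rinv_0_lt_compat, HN).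
apply Rmult_le_compat_r; [apply Rlt_le, Rinv_0_lt_compat, HN|].
eapply Rle_trans; [apply Rsum_abs|]. apply sum_Rle. intros i _. apply H.
Qed.

Lemma avg_const (M : nat) (c : R) : avg M (fun _ => c) = c.
Proof.
unfold avg. rewrite sum_cte. field. apply not_0_INR. lia.
Qed.

(** Multiplied by [2 sin (al / 2)], each cosine becomes a difference of sines at
    half-integer nodes, so that the sum telescopes. *)
Lemma sum_cos_telescope (al psi : R) (m : nat) :
  2 * sin (al / 2) * sum_f_R0 (fun q => cos (INR q * al + psi)) m =
  sin (INR (S m) * al - al / 2 + psi) - sin (psi - al / 2).
Proof.
assert (Hq : forall u, 2 * sin (al / 2) * cos u = sin (u + al / 2) - sin (u - al / 2)).
{ intros u. rewrite sin_plus, sin_minus. ring. }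
induction m as [|m IH].
- simpl sum_f_R0. rewrite Hq. simpl. f_equal; f_equal; try ring; field.
- rewrite tech5, Rmult_plus_distr_l, IH, Hq, (S_INR (S m)).
  replace (INR (S m) * al + psi - al / 2) with (INR (S m) * al - al / 2 + psi) by ring.
  replace ((INR (S m) + 1) * al - al / 2 + psi)
    with (INR (S m) * al + psi + al / 2) by field.
  ring.
Qed.

(** Discrete orthogonality: for [al = 2 PI j / (M + 1)] the two ends of the
    telescoping sum differ by [j] full periods, and [sin (al / 2) <> 0]. *)
Lemma avg_cos (M j : nat) (psi : R) : (0 < j <= M)%nat ->
  avg M (fun t => cos (INR j * t + psi)) = 0.
Proof.
intros Hj. assert (HN := lt_0_INR (S M) (Nat.lt_0_succ M)).
assert (HPI := PI_RGT_0).
set (al := 2 * PI * INR j / INR (S M)).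
unfold avg.
rewrite (sum_eq _ (fun q => cos (INR q * al + psi))).
2: { intros q _. f_equal. unfold al. field. lra. }
assert (Hs : 0 < sin (al / 2)).
{ replace (al / 2) with (PI * (INR j / INR (S M))) by (unfold al; field; lra).
  assert (0 < INR j / INR (S M) < 1).
  { split.
    - apply Rdiv_lt_0_compat; [apply lt_0_INR; lia|lra].
    - apply Rmult_lt_reg_r with (INR (S M)); [lra|].
      unfold Rdiv. rewrite Rmult_assoc, Rinv_l, Rmult_1_r, Rmult_1_l by lra.
      apply lt_INR. lia. }
  apply sin_gt_0; nra. }
assert (H := sum_cos_telescope al psi M).
replace (INR (S M) * al - al / 2 + psi)
  with (psi - al / 2 + 2 * INR j * PI) in H by (unfold al; field; lra).
rewrite sin_period in H.
assert (H0 : 2 * sin (al / 2) * sum_f_R0 (fun q => cos (INR q * al + psi)) M = 0) by lra.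
apply Rmult_integral in H0. destruct H0 as [H0|H0]; [lra|].
rewrite H0. unfold Rdiv. ring.
Qed.

Lemma avg_sin (M j : nat) (psi : R) : (0 < j <= M)%nat ->
  avg M (fun t => sin (INR j * t + psi)) = 0.
Proof.
intros Hj. rewrite <- (avg_cos M j (psi - PI / 2) Hj). apply avg_ext.
intros t. rewrite <- (cos_shift (INR j * t + psi)), <- cos_neg. f_equal. ring.
Qed.

Lemma avg_cos_sin (M k l : nat) (psi : R) : (0 < l)%nat -> (l + k <= M)%nat ->
  avg M (fun t => cos (INR k * t + psi) * (2 * sin (INR l * t))) =
  if (l =? k)%nat then - sin psi else 0.
Proof.
intros Hl HM.
assert (Hid : forall u v, cos u * (2 * sin v) = 1 * sin (v + u) + 1 * sin (v - u)).
{ intros u v. rewrite sin_plus, sin_minus. ring. }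
rewrite (avg_ext M _ (fun t => 1 * sin (INR (l + k) * t + psi)
  + 1 * sin (INR l * t - (INR k * t + psi)))).
2: { intros t. rewrite Hid, plus_INR. do 3 f_equal. ring. }
rewrite avg_lin, avg_sin by lia.
destruct (Nat.eqb_spec l k) as [->|Hne].
- rewrite (avg_ext M _ (fun _ => - sin psi)).
  + rewrite avg_const. ring.
  + intros t. rewrite <- sin_neg. f_equal. ring.
- destruct (Nat.lt_total l k) as [Hlt|[He|Hlt]]; [|lia|].
  + rewrite (avg_ext M _ (fun t => -1 * sin (INR (k - l) * t + psi) + 0 * 0)).
    * rewrite (avg_lin M (-1) 0 (fun t => sin (INR (k - l) * t + psi)) (fun _ => 0)).
      rewrite avg_sin by lia. ring.
    * intros t. rewrite minus_INR by lia.
      replace (INR l * t - (INR k * t + psi)) with (- ((INR k - INR l) * t + psi)) by ring.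
      rewrite sin_neg. ring.
  + rewrite (avg_ext M _ (fun t => sin (INR (l - k) * t + - psi))).
    * rewrite avg_sin by lia. ring.
    * intros t. rewrite minus_INR by lia. f_equal. ring.
Qed.

Lemma avg_cos_diff (M i j : nat) : (i <= M)%nat -> (j <= M)%nat ->
  avg M (fun t => cos ((INR i - INR j) * t)) = if (j =? i)%nat then 1 else 0.
Proof.
intros Hi Hj. destruct (Nat.eqb_spec j i) as [->|Hne].
- rewrite (avg_ext M _ (fun _ => 1)); [apply avg_const|].
  intros t. replace ((INR i - INR i) * t) with 0 by ring. apply cos_0.
- destruct (Nat.lt_total i j) as [Hlt|[He|Hlt]]; [|lia|].
  + rewrite <- (avg_cos M (j - i) 0) by lia. apply avg_ext. intros t.
    rewrite <- cos_neg, minus_INR by lia. f_equal. ring.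
  + rewrite <- (avg_cos M (i - j) 0) by lia. apply avg_ext. intros t.
    rewrite minus_INR by lia. f_equal. ring.
Qed.

(** * The differentiating kernel *)

Lemma sum_single (a m : nat) (c : R) :
  sum_f_R0 (fun j => if (j =? a)%nat then c else 0) m =
  if (a <=? m)%nat then c else 0.
Proof.
induction m as [|m IH].
- simpl. destruct a; reflexivity.
- rewrite tech5, IH.
  destruct (Nat.leb_spec a m), (Nat.eqb_spec (S m) a), (Nat.leb_spec a (S m));
    try lia; ring.
Qed.

Lemma sum_initial (k m : nat) (c : R) : (k <= S m)%nat ->
  sum_f_R0 (fun i => if (i <? k)%nat then c else 0) m = INR k * c.
Proof.
revert k. induction m as [|m IH]; intros k Hk.
- destruct k as [|[|k]]; simpl; try ring. lia.
- rewrite tech5. destruct (Nat.ltb_spec (S m) k).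
  + rewrite (sum_eq _ (fun i => if (i <? S m)%nat then c else 0)).
    * rewrite IH by lia. replace k with (S (S m)) by lia.
      rewrite (S_INR (S m)). ring.
    * intros i Hi. destruct (Nat.ltb_spec i k), (Nat.ltb_spec i (S m)); try lia; reflexivity.
  + rewrite IH by lia. ring.
Qed.

(** [4 * ksin * kcos] is the imaginary part of
    [2 * (sum_(l <= m) e^(i (l + 1/2) t)) ^ 2], where the frequency [k <= m + 1] occurs
    exactly [k] times; convolution with it therefore multiplies a frequency [k]
    by [k], which is differentiation up to a shift of phase. *)
Definition ksin (m : nat) (t : R) : R := sum_f_R0 (fun i => sin ((INR i + / 2) * t)) m.

Definition kcos (m : nat) (t : R) : R := sum_f_R0 (fun i => cos ((INR i + / 2) * t)) m.

Lemma sum_prod (u v : nat -> R) (m : nat) :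
  sum_f_R0 u m * sum_f_R0 v m =
  sum_f_R0 (fun i => sum_f_R0 (fun j => u i * v j) m) m.
Proof.
rewrite Rmult_comm, scal_sum. apply sum_eq. intros i _.
rewrite scal_sum. apply sum_eq. intros j _. ring.
Qed.

Lemma kernel_expand (m : nat) (t : R) :
  4 * ksin m t * kcos m t =
  sum_f_R0 (fun i => sum_f_R0 (fun j => 2 * sin (INR (i + j + 1) * t)) m) m.
Proof.
transitivity (2 * (ksin m t * kcos m t) + 2 * (kcos m t * ksin m t)); [ring|].
unfold ksin, kcos. rewrite !sum_prod, !scal_sum, <- sum_plus.
apply sum_eq. intros i _.
rewrite !(Rmult_comm (sum_f_R0 _ _) 2), !scal_sum, <- sum_plus.
apply sum_eq. intros j _.
rewrite !plus_INR.
replace ((INR i + INR j + INR 1) * t)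
  with ((INR i + / 2) * t + (INR j + / 2) * t) by (simpl; field).
rewrite sin_plus. ring.
Qed.

Lemma kernel_square_expand (m : nat) (t : R) :
  (ksin m t) ^ 2 + (kcos m t) ^ 2 =
  sum_f_R0 (fun i => sum_f_R0 (fun j => cos ((INR i - INR j) * t)) m) m.
Proof.
transitivity (ksin m t * ksin m t + kcos m t * kcos m t); [ring|].
unfold ksin, kcos. rewrite !sum_prod, <- sum_plus.
apply sum_eq. intros i _. rewrite <- sum_plus. apply sum_eq. intros j _.
replace ((INR i - INR j) * t)
  with ((INR i + / 2) * t - (INR j + / 2) * t) by ring.
rewrite cos_minus. ring.
Qed.

(** Twice the square sum dominates the kernel pointwise, and its average is small
    because only the diagonal terms [i = j] survive. *)
Lemma kernel_mass (M m : nat) : (m <= M)%nat ->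
  avg M (fun t => (ksin m t) ^ 2 + (kcos m t) ^ 2) = INR (S m).
Proof.
intros HM.
rewrite (avg_ext M _ _ (kernel_square_expand m)), avg_sum.
rewrite (sum_eq _ (fun i => if (i <? S m)%nat then 1 else 0)).
- rewrite sum_initial by lia. ring.
- intros i Hi. rewrite avg_sum.
  rewrite (sum_eq _ (fun j => if (j =? i)%nat then 1 else 0)).
  + rewrite sum_single.
    destruct (Nat.leb_spec i m), (Nat.ltb_spec i (S m)); try lia; reflexivity.
  + intros j Hj. apply avg_cos_diff; lia.
Qed.

(** With [3 m + 2] nodes no frequency [k + i + j + 1] aliases to [0]; exactly
    the [k] pairs with [i + j + 1 = k] contribute. *)
Lemma kernel_derivative (m k : nat) (psi : R) : (k <= m)%nat ->
  avg (3 * m + 1) (fun t => cos (INR k * t + psi) * (4 * ksin m t * kcos m t)) =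
  - INR k * sin psi.
Proof.
intros Hk.
rewrite (avg_ext _ _ (fun t => sum_f_R0 (fun i => sum_f_R0 (fun j =>
  cos (INR k * t + psi) * (2 * sin (INR (i + j + 1) * t))) m) m)).
2: { intros t. rewrite kernel_expand, scal_sum. apply sum_eq. intros i _.
     rewrite Rmult_comm, scal_sum. apply sum_eq. intros j _. ring. }
rewrite avg_sum.
rewrite (sum_eq _ (fun i => if (i <? k)%nat then - sin psi else 0)).
- rewrite sum_initial by lia. ring.
- intros i Hi. rewrite avg_sum.
  destruct (Nat.ltb_spec i k) as [Hik|Hik].
  + rewrite (sum_eq _ (fun j => if (j =? k - 1 - i)%nat then - sin psi else 0)).
    * rewrite sum_single. destruct (Nat.leb_spec (k - 1 - i) m); [reflexivity|lia].
    * intros j Hj. rewrite avg_cos_sin by lia.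
      destruct (Nat.eqb_spec (i + j + 1) k), (Nat.eqb_spec j (k - 1 - i));
        try lia; reflexivity.
  + rewrite (sum_eq _ (fun _ => 0)).
    * rewrite sum_cte. ring.
    * intros j Hj. rewrite avg_cos_sin by lia.
      destruct (Nat.eqb_spec (i + j + 1) k); [lia|reflexivity].
Qed.

(** * Trigonometric polynomials *)

(** Trigonometric polynomials of degree at most [m], generated by phase-shifted
    cosines: the facts below are linear in the polynomial, so induction on this
    presentation replaces computation with coefficients. *)
Inductive trig (m : nat) : (R -> R) -> Prop :=
| trig_cos k psi : (k <= m)%nat -> trig m (fun x => cos (INR k * x + psi))
| trig_lin a b f g : trig m f -> trig m g -> trig m (fun x => a * f x + b * g x)
| trig_ext f g : (forall x, f x = g x) -> trig m f -> trig m g.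

Lemma trig_le (m m' : nat) (f : R -> R) : (m <= m')%nat -> trig m f -> trig m' f.
Proof.
intros Hm. induction 1 as [k psi Hk|a b f g _ Hf _ Hg|f g He _ Hf].
- apply trig_cos. lia.
- now apply trig_lin.
- now apply trig_ext with f.
Qed.

Lemma trig_const (m : nat) (c : R) : trig m (fun _ => c).
Proof.
apply trig_ext with (fun x => c * cos (INR 0 * x + 0) + 0 * cos (INR 0 * x + 0)).
- intros x. simpl. rewrite Rmult_0_l, Rplus_0_r, cos_0. ring.
- apply trig_lin; apply trig_cos; lia.
Qed.

Lemma trig_mult_cos (m : nat) (f : R -> R) :
  trig m f -> trig (S m) (fun x => cos x * f x).
Proof.
induction 1 as [k psi Hk|a b f g _ Hf _ Hg|f g He _ Hf].
- apply trig_ext with (fun x => / 2 * cos (INR (k + 1) * x + psi)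
                    + / 2 * cos ((INR k - 1) * x + psi)).
  + intros x. rewrite plus_INR. simpl (INR 1).
    replace ((INR k + 1) * x + psi) with (INR k * x + psi + x) by ring.
    replace ((INR k - 1) * x + psi) with (INR k * x + psi - x) by ring.
    rewrite cos_plus, cos_minus. field.
  + apply trig_lin; [apply trig_cos; lia|]. destruct k as [|k].
    * apply trig_ext with (fun x => cos (INR 1 * x + - psi)); [|apply trig_cos; lia].
      intros x. rewrite <- cos_neg. f_equal. simpl. ring.
    * apply trig_ext with (fun x => cos (INR k * x + psi)); [|apply trig_cos; lia].
      intros x. rewrite S_INR. f_equal. ring.
- apply trig_ext with (fun x => a * (cos x * f x) + b * (cos x * g x)).
  + intros x. ring.
  + now apply trig_lin.
- apply trig_ext with (fun x => cos x * f x); [|exact Hf]. intros x. now rewrite He.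
Qed.

Lemma trig_translate (m : nat) (h : R) (f : R -> R) :
  trig m f -> trig m (fun x => f (x + h)).
Proof.
induction 1 as [k psi Hk|a b f g _ Hf _ Hg|f g He _ Hf].
- apply trig_ext with (fun x => cos (INR k * x + (INR k * h + psi))); [|now apply trig_cos].
  intros x. f_equal. ring.
- now apply trig_lin.
- now apply trig_ext with (fun x => f (x + h)).
Qed.

Lemma trigpoly_trig (n : nat) (f : R -> R) : trigpoly n f -> trig n f.
Proof.
intros [m [a [b [Hm He]]]].
apply trig_ext with (fun x => sum_f_R0
  (fun k => a k * cos (INR k * x) + b k * sin (INR k * x)) m);
  [intros x; now rewrite He|clear He].
assert (Hterm : forall k, (k < n)%nat ->
  trig n (fun x => a k * cos (INR k * x) + b k * sin (INR k * x))).
{ intros k Hk. apply trig_ext with (fun x => a k * cos (INR k * x + 0)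
    + b k * cos (INR k * x + - (PI / 2))).
  - intros x. rewrite Rplus_0_r, <- (cos_neg (INR k * x + _)), <- (cos_shift (INR k * x)).
    do 3 f_equal. ring.
  - apply trig_lin; apply trig_cos; lia. }
induction m as [|m IH]; [now apply Hterm|].
apply trig_ext with (fun x => 1 * sum_f_R0
  (fun k => a k * cos (INR k * x) + b k * sin (INR k * x)) m
  + 1 * (a (S m) * cos (INR (S m) * x) + b (S m) * sin (INR (S m) * x))).
- intros x. rewrite tech5. ring.
- apply trig_lin; [apply IH; lia|apply Hterm; lia].
Qed.

(** The derivative is an average of translates; this is the identity of
    [kernel_derivative] extended by linearity. *)
Lemma trig_derive (m : nat) (f : R -> R) : trig m f -> exists f',
  trig m f' /\ (forall x, is_derive f x (f' x)) /\
  (forall x, f' x =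
     avg (3 * m + 1) (fun t => f (x + t) * (4 * ksin m t * kcos m t))).
Proof.
induction 1 as [k psi Hk|a b f g _ [f' [Hf [Df Af]]] _ [g' [Hg [Dg Ag]]]
               |f g He _ [f' [Hf [Df Af]]]].
- exists (fun x => - INR k * sin (INR k * x + psi)). (split; [|split]).
  + apply trig_ext with (fun x => INR k * cos (INR k * x + (psi + PI / 2))
                                  + 0 * cos (INR k * x + psi)).
    * intros x. replace (INR k * x + (psi + PI / 2))
        with (PI / 2 + (INR k * x + psi)) by ring.
      rewrite (sin_cos (INR k * x + psi)). ring.
    * apply trig_lin; now apply trig_cos.
  + intros x. auto_derive; [easy|ring].
  + intros x. rewrite <- (kernel_derivative m k) by easy.
    apply avg_ext. intros t. f_equal. f_equal. ring.
- exists (fun x => a * f' x + b * g' x). (split; [|split]).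
  + now apply trig_lin.
  + intros x. apply (is_derive_plus (K := R_AbsRing) (V := R_NormedModule));
      apply is_derive_scal; auto.
  + intros x. rewrite Af, Ag, <- avg_lin. apply avg_ext. intros t. ring.
- exists f'. (split; [exact Hf|split]).
  + intros x. now apply (is_derive_ext f).
  + intros x. rewrite Af. apply avg_ext. intros t. now rewrite He.
Qed.

Lemma trig_Derive_n (m k : nat) (f : R -> R) : trig m f -> trig m (Derive_n f k).
Proof.
intros Hf. induction k as [|k IH]; [exact Hf|].
destruct (trig_derive m _ IH) as [f' [Hf' [Df _]]].
apply trig_ext with f'; [|exact Hf'].
intros y. symmetry. now apply is_derive_unique.
Qed.

(** Follows from [trig_derive] since [|4 u v| <= 2 (u^2 + v^2)] and the average of
    [ksin^2 + kcos^2] is [m + 1]. *)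
Lemma bernstein (m : nat) (f : R -> R) (B : R) : trig m f ->
  (forall x, Rabs (f x) <= B) -> forall x, Rabs (Derive f x) <= 2 * INR (S m) * B.
Proof.
intros Hf HB x. destruct (trig_derive m f Hf) as [f' [_ [Df Af]]].
rewrite (is_derive_unique _ _ _ (Df x)), Af.
replace (2 * INR (S m) * B) with
  (avg (3 * m + 1) (fun t => 2 * B * ((ksin m t) ^ 2 + (kcos m t) ^ 2) + 0 * 0)).
- apply avg_abs_le. intros t. rewrite Rabs_mult.
  assert (H1 := HB (x + t)). assert (H0 := Rabs_pos (f (x + t))).
  assert (Rabs (4 * ksin m t * kcos m t) <= 2 * ((ksin m t) ^ 2 + (kcos m t) ^ 2)).
  { apply Rabs_le. split; [assert (H := pow2_ge_0 (ksin m t + kcos m t))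
                          |assert (H := pow2_ge_0 (ksin m t - kcos m t))]; nra. }
  assert (H2 := Rabs_pos (4 * ksin m t * kcos m t)).
  apply Rle_trans with (B * (2 * ((ksin m t) ^ 2 + (kcos m t) ^ 2))); [|lra].
  now apply Rmult_le_compat.
- rewrite (avg_lin _ (2 * B) 0 (fun t => (ksin m t) ^ 2 + (kcos m t) ^ 2) (fun _ => 0)).
  rewrite kernel_mass by lia. ring.
Qed.

(** * Calculus of functions of class C^k *)

(** Continuous differentiability up to order [k], peeling derivatives from the
    inside so that closure properties are proved by induction on [k]. *)
Fixpoint smooth (k : nat) (f : R -> R) : Prop :=
  match k with
  | O => forall x : R, continuous f x
  | S k => (forall x : R, ex_derive f x) /\ smooth k (Derive f)
  end.

Lemma smooth_ext (k : nat) (f g : R -> R) :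
  (forall x, f x = g x) -> smooth k f -> smooth k g.
Proof.
revert f g. induction k as [|k IH]; simpl; intros f g He Hf.
- intros x. now apply (continuous_ext f).
- destruct Hf as [H1 H2]. split.
  + intros x. now apply (ex_derive_ext f).
  + apply (IH (Derive f)); [|exact H2]. intros x. now apply Derive_ext.
Qed.

Lemma smooth_S (k : nat) (f f' : R -> R) :
  (forall x, is_derive f x (f' x)) -> smooth k f' -> smooth (S k) f.
Proof.
intros Hd Hs. split.
- intros x. now exists (f' x).
- apply (smooth_ext k f'); [|exact Hs].
  intros x. symmetry. now apply is_derive_unique.
Qed.

Lemma smooth_continuous (k : nat) (f : R -> R) :
  smooth k f -> forall x, continuous f x.
Proof.
destruct k; [easy|]. intros [H _] x. now apply (ex_derive_continuous (V := R_NormedModule)).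
Qed.

Lemma smooth_pred (k : nat) (f : R -> R) : smooth (S k) f -> smooth k f.
Proof.
revert f. induction k as [|k IH]; intros f Hf.
- intros x. now apply smooth_continuous with 1%nat.
- destruct Hf as [H1 H2]. split; [exact H1|now apply IH].
Qed.

Lemma smooth_plus (k : nat) (f g : R -> R) :
  smooth k f -> smooth k g -> smooth k (fun x => f x + g x).
Proof.
revert f g. induction k as [|k IH]; intros f g Hf Hg.
- intros x. apply (continuous_plus (V := R_NormedModule)); [apply Hf|apply Hg].
- destruct Hf as [Df Hf], Hg as [Dg Hg].
  apply smooth_S with (fun x => Derive f x + Derive g x).
  + intros x. apply (is_derive_plus (K := R_AbsRing) (V := R_NormedModule));
      now apply Derive_correct.
  + now apply IH.
Qed.

Lemma smooth_const (k : nat) (c : R) : smooth k (fun _ => c).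
Proof.
revert c. induction k as [|k IH]; intros c.
- intros x. apply continuous_const.
- apply smooth_S with (fun _ => 0); [|apply IH].
  intros x. apply (is_derive_const (K := R_AbsRing) (V := R_NormedModule)).
Qed.

Lemma smooth_mult (k : nat) (f g : R -> R) :
  smooth k f -> smooth k g -> smooth k (fun x => f x * g x).
Proof.
revert f g. induction k as [|k IH]; intros f g Hf Hg.
- intros x. apply (continuous_mult (K := R_AbsRing)); [apply Hf|apply Hg].
- assert (Hf' := smooth_pred _ _ Hf). assert (Hg' := smooth_pred _ _ Hg).
  destruct Hf as [Df Hf], Hg as [Dg Hg].
  apply smooth_S with (fun x => Derive f x * g x + f x * Derive g x).
  + intros x. apply (is_derive_mult (K := R_AbsRing) f g x).
    * now apply Derive_correct.
    * now apply Derive_correct.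
    * exact Rmult_comm.
  + apply smooth_plus; now apply IH.
Qed.

Lemma smooth_id (k : nat) : smooth k (fun x => x).
Proof.
destruct k; [intros x; apply continuous_id|].
apply smooth_S with (fun _ => 1); [|apply smooth_const].
intros x. apply (is_derive_id (K := R_AbsRing)).
Qed.

Lemma smooth_pow (k m : nat) (f : R -> R) : smooth k f -> smooth k (fun x => f x ^ m).
Proof.
intros Hf. induction m as [|m IH]; [exact (smooth_const k 1)|].
exact (smooth_mult k f _ Hf IH).
Qed.

Lemma smooth_comp (k : nat) (f g : R -> R) :
  smooth k f -> smooth k g -> smooth k (fun x => f (g x)).
Proof.
revert f g. induction k as [|k IH]; intros f g Hf Hg.
- intros x. apply (continuous_comp g f); [apply Hg|apply Hf].
- assert (Hg' := smooth_pred _ _ Hg).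
  destruct Hf as [Df Hf], Hg as [Dg Hg].
  apply smooth_S with (fun x => Derive g x * Derive f (g x)).
  + intros x. apply (is_derive_comp (K := R_AbsRing) (V := R_NormedModule) f g).
    * now apply Derive_correct.
    * now apply Derive_correct.
  + apply smooth_mult; [exact Hg|now apply IH].
Qed.

Lemma smooth_cos (k : nat) (a b : R) : smooth k (fun x => cos (a * x + b)).
Proof.
revert b. induction k as [|k IH]; intros b.
- intros x. apply (ex_derive_continuous (V := R_NormedModule)). now auto_derive.
- apply smooth_S with (fun x => a * cos (a * x + (b + PI / 2))).
  + intros x. auto_derive; [easy|].
    rewrite (sin_cos (a * x + b)).
    replace (a * x + (b + PI / 2)) with (PI / 2 + (a * x + b)) by ring. ring.
  + apply smooth_mult; [apply smooth_const|apply IH].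
Qed.

Lemma smooth_sin_half (k : nat) : smooth k (fun x => sin (x / 2)).
Proof.
apply (smooth_ext k (fun x => cos (/ 2 * x + (- (PI / 2))))); [|apply smooth_cos].
intros x. rewrite <- cos_shift, <- cos_neg. f_equal. field.
Qed.

Lemma smooth_cos_half (k : nat) : smooth k (fun x => cos (x / 2)).
Proof.
apply (smooth_ext k (fun x => cos (/ 2 * x + 0))); [|apply smooth_cos].
intros x. f_equal. field.
Qed.

Lemma smooth_trig (k m : nat) (f : R -> R) : trig m f -> smooth k f.
Proof.
revert f. induction k as [|k IH]; intros f Hf;
  destruct (trig_derive m f Hf) as [f' [Hf' [Df _]]].
- intros x. apply (ex_derive_continuous (V := R_NormedModule)). now exists (f' x).
- apply smooth_S with f'; [exact Df|now apply IH].
Qed.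

Lemma Derive_n_shift (f : R -> R) (k : nat) (x : R) :
  Derive_n f (S k) x = Derive_n (Derive f) k x.
Proof.
change (Derive f) with (Derive_n f 1). rewrite Derive_n_comp. f_equal. lia.
Qed.

Lemma smooth_ex_derive_n (k : nat) (f : R -> R) : smooth k f ->
  forall j x, (j <= k)%nat -> ex_derive_n f j x.
Proof.
revert f. induction k as [|k IH]; intros f Hf j x Hj.
- replace j with O by lia. exact I.
- destruct Hf as [Df Hf]. destruct j as [|[|j]]; [exact I|apply Df|].
  apply (ex_derive_ext (Derive_n (Derive f) j)).
  + intros t. symmetry. apply Derive_n_shift.
  + apply (IH _ Hf (S j)). lia.
Qed.

Lemma smooth_Derive_n (i k : nat) (f : R -> R) :
  smooth (i + k) f -> smooth i (Derive_n f k).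
Proof.
revert f. induction k as [|k IH]; intros f Hf.
- now rewrite Nat.add_0_r in Hf.
- rewrite Nat.add_succ_r in Hf. destruct Hf as [_ Hf].
  apply (smooth_ext i (Derive_n (Derive f) k)); [|now apply IH].
  intros x. symmetry. apply Derive_n_shift.
Qed.

Lemma smooth_Cr (k : nat) (f : R -> R) :
  smooth k f -> (forall x, f (x + 2 * PI) = f x) -> Cr k f.
Proof.
intros Hf Hp. split; [|split].
- split; [now apply smooth_continuous with k|exact Hp].
- intros j x Hj. now apply smooth_ex_derive_n with k.
- exact (smooth_Derive_n 0 k f Hf).
Qed.

Lemma Derive_n_lin (k : nat) (a : R) (f g : R -> R) (x : R) :
  smooth k f -> smooth k g ->
  Derive_n (fun y => f y + a * g y) k x = Derive_n f k x + a * Derive_n g k x.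
Proof.
intros Hf Hg.
rewrite <- Derive_n_scal_l, <- (Derive_n_plus f (fun y => a * g y)); [easy| |].
- exists (mkposreal 1 Rlt_0_1). intros y _ j Hj. now apply smooth_ex_derive_n with k.
- exists (mkposreal 1 Rlt_0_1). intros y _ j Hj. apply smooth_ex_derive_n with k; [|exact Hj].
  apply smooth_mult; [apply smooth_const|exact Hg].
Qed.

(** Truncated powers are the building blocks of a cutoff of finite smoothness:
    the power [k + 1] is of class [C^k]. *)
Definition tpow (k : nat) (x : R) : R := (Rmax 0 x) ^ k.

Lemma tpow_derive (k : nat) (x : R) :
  is_derive (tpow (S (S k))) x (INR (S (S k)) * tpow (S k) x).
Proof.
unfold tpow.
destruct (Rtotal_order x 0) as [Hx|[->|Hx]].
- rewrite Rmax_left by lra.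
  replace (INR (S (S k)) * 0 ^ S k) with 0 by (simpl; ring).
  apply (is_derive_ext_loc (fun _ => 0)).
  + exists (mkposreal (- x) ltac:(lra)). intros y Hy.
    change (Rabs (y - x) < - x) in Hy. apply Rabs_def2 in Hy.
    rewrite Rmax_left by lra. simpl. ring.
  + apply (is_derive_const (K := R_AbsRing) (V := R_NormedModule)).
- rewrite Rmax_left by lra.
  replace (INR (S (S k)) * 0 ^ S k) with 0 by (simpl; ring).
  split; [apply is_linear_scal_l|].
  intros y Hy.
  apply (is_filter_lim_locally_unique (K := R_AbsRing) (V := R_NormedModule)) in Hy.
  subst y.
  intros eps. assert (He := cond_pos eps).
  assert (Hm : 0 < Rmin 1 eps) by (apply Rmin_pos; lra).
  exists (mkposreal _ Hm). intros y Hy.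
  change (Rabs (y - 0) < Rmin 1 eps) in Hy. rewrite Rminus_0_r in Hy.
  change (Rabs (Rmax 0 y ^ S (S k) - Rmax 0 0 ^ S (S k) - (y - 0) * 0)
          <= eps * Rabs (y - 0)).
  rewrite (Rmax_left 0 0), Rmult_0_r, Rminus_0_r, Rminus_0_r by lra.
  replace (0 ^ S (S k)) with 0 by (simpl; ring). rewrite Rminus_0_r.
  assert (H1 := Rmin_l 1 eps). assert (H2 := Rmin_r 1 eps).
  destruct (Rle_dec y 0) as [Hy0|Hy0].
  + rewrite Rmax_left by lra. replace (0 ^ S (S k)) with 0 by (simpl; ring).
    rewrite Rabs_R0. apply Rmult_le_pos; [lra|apply Rabs_pos].
  + rewrite Rmax_right by lra. rewrite (Rabs_pos_eq y) in * by lra.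
    rewrite Rabs_pos_eq by (apply pow_le; lra).
    assert (H3 : y ^ k <= 1) by (rewrite <- (pow1 k); apply pow_incr; lra).
    assert (H4 : 0 <= y ^ k) by (apply pow_le; lra).
    simpl. assert (0 <= y * y ^ k) by nra. nra.
- rewrite Rmax_right by lra.
  apply (is_derive_ext_loc (fun y => y ^ S (S k))).
  + exists (mkposreal x Hx). intros y Hy.
    change (Rabs (y - x) < x) in Hy. apply Rabs_def2 in Hy.
    rewrite Rmax_right by lra. reflexivity.
  + replace (INR (S (S k)) * x ^ S k) with (INR (S (S k)) * 1 * x ^ S k) by ring.
    apply (is_derive_pow (fun y => y) (S (S k)) x 1), (is_derive_id (K := R_AbsRing)).
Qed.

Lemma smooth_tpow (k : nat) : smooth k (tpow (S k)).
Proof.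
induction k as [|k IH].
- intros x. apply (continuous_ext (fun y => (y + Rabs y) * / 2)).
  + intros y. unfold tpow. simpl. rewrite Rmult_1_r.
    unfold Rmax, Rabs. destruct (Rle_dec 0 y), (Rcase_abs y); lra.
  + apply (continuous_mult (K := R_AbsRing)); [|apply continuous_const].
    apply (continuous_plus (V := R_NormedModule)); [apply continuous_id|].
    apply continuous_Rabs.
- apply smooth_S with (fun x => INR (S (S k)) * tpow (S k) x).
  + apply tpow_derive.
  + apply smooth_mult; [apply smooth_const|exact IH].
Qed.

Lemma tpow_nonneg (k : nat) (x : R) : 0 <= tpow k x.
Proof. apply pow_le, Rmax_l. Qed.

Lemma tpow_incr (k : nat) (x y : R) : x <= y -> tpow k x <= tpow k y.
Proof.
intros H. apply pow_incr. split; [apply Rmax_l|].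
apply Rle_max_compat_l, H.
Qed.

Lemma tpow_neg (k : nat) (x : R) : x <= 0 -> tpow (S k) x = 0.
Proof. intros H. unfold tpow. rewrite Rmax_left by easy. simpl. ring. Qed.

Lemma tpow_one (k : nat) : tpow k 1 = 1.
Proof. unfold tpow. rewrite Rmax_right by lra. apply pow1. Qed.

(** * Consequences of Bernstein's inequality *)

Lemma bernstein_n (m k : nat) (f : R -> R) (B : R) : trig m f ->
  (forall x, Rabs (f x) <= B) ->
  forall x, Rabs (Derive_n f k x) <= (2 * INR (S m)) ^ k * B.
Proof.
revert f B. induction k as [|k IH]; intros f B Hf HB x.
- simpl. rewrite Rmult_1_l. apply HB.
- rewrite Derive_n_shift.
  replace ((2 * INR (S m)) ^ S k * B) with ((2 * INR (S m)) ^ k * (2 * INR (S m) * B))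
    by (simpl; ring).
  apply IH; [|now apply bernstein].
  destruct (trig_derive m f Hf) as [f' [Hf' [Df _]]].
  apply trig_ext with f'; [|exact Hf'].
  intros y. symmetry. now apply is_derive_unique.
Qed.

Lemma trig_difference (m : nat) (h B : R) (f : R -> R) : 0 < h -> trig m f ->
  (forall x, Rabs (f x) <= B) ->
  trig m (fun x => f (x + h) - f x) /\
  forall x, Rabs (f (x + h) - f x) <= 2 * INR (S m) * h * B.
Proof.
intros Hh Hf HB. split.
- apply trig_ext with (fun x => 1 * f (x + h) + (-1) * f x); [intros x; ring|].
  apply trig_lin; [now apply trig_translate|exact Hf].
- intros x. destruct (smooth_trig 1 m f Hf) as [Df _].
  destruct (MVT_gen f x (x + h) (Derive f)) as [c [_ Hc]].
  + intros y _. now apply Derive_correct.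
  + intros y _. apply continuity_pt_filterlim.
    now apply (ex_derive_continuous (V := R_NormedModule)).
  + rewrite Hc. replace (x + h - x) with h by ring.
    rewrite Rabs_mult, (Rabs_pos_eq h) by lra.
    replace (2 * INR (S m) * h * B) with (2 * INR (S m) * B * h) by ring.
    apply Rmult_le_compat_r; [lra|]. now apply bernstein.
Qed.

Lemma fdiff3 (h : R) (g : R -> R) (x : R) :
  fdiff 3 h g x = g x - 3 * g (x + h) + 3 * g (x + 2 * h) - g (x + 3 * h).
Proof.
unfold fdiff. simpl sum_f_R0. unfold Binomial.C. simpl.
rewrite Rmult_0_l, Rplus_0_r, !Rmult_1_l.
replace (1 + 1) with 2 by ring. replace (2 + 1) with 3 by ring. field.
Qed.

(** Third differences of the trigonometric part are bounded by applying
    [trig_difference] three times, those of the rest by the sum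
    [1 + 3 + 3 + 1] of the absolute values of the coefficients. *)
Lemma omega3_le (m : nat) (B e t : R) (g q d : R -> R) : Cper g -> 0 < t ->
  (forall x, g x = q x + d x) ->
  trig m q -> (forall x, Rabs (q x) <= B) -> (forall x, Rabs (d x) <= e) ->
  omega 3 g t <= (2 * INR (S m) * t) ^ 3 * B + 8 * e.
Proof.
intros Hg Ht Hsum Hq HB He.
apply (omega_lub 3 g t Hg Ht). intros z [h [Hh ->]].
destruct (supnorm_max _ (Cper_fdiff 3 h g Hg)) as [x [-> _]].
assert (HB0 : 0 <= B) by (eapply Rle_trans; [apply Rabs_pos|apply (HB 0)]).
assert (Hm : 0 < 2 * INR (S m)) by (assert (H := lt_0_INR (S m) (Nat.lt_0_succ m)); lra).
destruct (trig_difference m h B q) as [T1 B1]; [easy..|].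
destruct (trig_difference m h _ _ (proj1 Hh) T1 B1) as [T2 B2].
destruct (trig_difference m h _ _ (proj1 Hh) T2 B2) as [_ B3].
assert (H1 : Rabs (fdiff 3 h q x) <= (2 * INR (S m) * t) ^ 3 * B).
{ replace (fdiff 3 h q x) with (- (q (x + h + h + h) - q (x + h + h) - (q (x + h + h) - q (x + h)) -
    (q (x + h + h) - q (x + h) - (q (x + h) - q x)))).
  - rewrite Rabs_Ropp. eapply Rle_trans; [apply B3|].
    replace (2 * INR (S m) * h * (2 * INR (S m) * h * (2 * INR (S m) * h * B)))
      with ((2 * INR (S m) * h) ^ 3 * B) by ring.
    apply Rmult_le_compat_r; [exact HB0|]. apply pow_incr. split.
    + apply Rmult_le_pos; lra.
    + apply Rmult_le_compat_l; lra.
  - rewrite fdiff3. replace (x + 2 * h) with (x + h + h) by ring.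
    replace (x + 3 * h) with (x + h + h + h) by ring. ring. }
assert (H2 : Rabs (fdiff 3 h d x) <= 8 * e).
{ rewrite fdiff3.
  assert (E0 := He x). assert (E1 := He (x + h)).
  assert (E2 := He (x + 2 * h)). assert (E3 := He (x + 3 * h)).
  apply Rabs_le_between in E0, E1, E2, E3. apply Rabs_le. lra. }
replace (fdiff 3 h g x) with (fdiff 3 h q x + fdiff 3 h d x).
- eapply Rle_trans; [apply Rabs_triang|lra].
- rewrite !fdiff3, !Hsum. ring.
Qed.

(** * Families of functions living at a small scale *)

(** The family [f a], [0 < a <= 1], has derivatives of order [j <= k] bounded by
    a constant times [a ^ (- j)], uniformly in [a]. *)
Fixpoint scaled (k : nat) (f : R -> R -> R) : Prop :=
  (exists B, forall a x : R, 0 < a <= 1 -> Rabs (f a x) <= B) /\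
  match k with
  | O => forall a x : R, 0 < a <= 1 -> continuous (f a) x
  | S k => exists f' : R -> R -> R, (forall a x : R, 0 < a <= 1 -> is_derive (f a) x (f' a x / a))
                      /\ scaled k f'
  end.

Lemma scaled_bounded (k : nat) (f : R -> R -> R) : scaled k f ->
  exists B, forall a x, 0 < a <= 1 -> Rabs (f a x) <= B.
Proof. destruct k; now intros [H _]. Qed.

Lemma scaled_pred (k : nat) (f : R -> R -> R) : scaled (S k) f -> scaled k f.
Proof.
revert f. induction k as [|k IH]; intros f [HB [f' [Hd Hf]]]; split; try exact HB.
- intros a x Ha. apply (ex_derive_continuous (V := R_NormedModule)).
  exists (f' a x / a). now apply Hd.
- exists f'. split; [exact Hd|now apply IH].
Qed.

Lemma scaled_plus (k : nat) (f g : R -> R -> R) :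
  scaled k f -> scaled k g -> scaled k (fun a x => f a x + g a x).
Proof.
revert f g. induction k as [|k IH];
  intros f g [[Bf HBf] Hf] [[Bg HBg] Hg]; split.
- exists (Bf + Bg). intros a x Ha. eapply Rle_trans; [apply Rabs_triang|].
  apply Rplus_le_compat; auto.
- intros a x Ha. apply (continuous_plus (V := R_NormedModule)); auto.
- exists (Bf + Bg). intros a x Ha. eapply Rle_trans; [apply Rabs_triang|].
  apply Rplus_le_compat; auto.
- destruct Hf as [f' [Df Hf]], Hg as [g' [Dg Hg]].
  exists (fun a x => f' a x + g' a x). split; [|now apply IH].
  intros a x Ha. rewrite Rdiv_plus_distr.
  apply (is_derive_plus (K := R_AbsRing) (V := R_NormedModule)); auto.
Qed.

Lemma scaled_mult (k : nat) (f g : R -> R -> R) :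
  scaled k f -> scaled k g -> scaled k (fun a x => f a x * g a x).
Proof.
revert f g. induction k as [|k IH]; intros f g Hf Hg;
  destruct (scaled_bounded _ _ Hf) as [Bf HBf], (scaled_bounded _ _ Hg) as [Bg HBg];
  (split; [exists (Bf * Bg); intros a x Ha; rewrite Rabs_mult;
           apply Rmult_le_compat; auto using Rabs_pos|]).
- intros a x Ha. apply (continuous_mult (K := R_AbsRing)); [now apply Hf|now apply Hg].
- assert (Hf0 := scaled_pred _ _ Hf). assert (Hg0 := scaled_pred _ _ Hg).
  destruct Hf as [_ [f' [Df Hf]]], Hg as [_ [g' [Dg Hg]]].
  exists (fun a x => f' a x * g a x + f a x * g' a x). split.
  + intros a x Ha.
    replace ((f' a x * g a x + f a x * g' a x) / a)
      with (f' a x / a * g a x + f a x * (g' a x / a)) by (field; lra).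
    apply (is_derive_mult (K := R_AbsRing) (f a) (g a) x); auto.
    exact Rmult_comm.
  + apply scaled_plus; apply IH; auto.
Qed.

(** The power of [a] is there for the induction: in the scaled sense the
    derivative of [cos (x / 2)] is [a] times a bounded function. *)
Lemma scaled_cos (k j : nat) (c psi : R) :
  scaled k (fun a x => a ^ j * c * cos (x / 2 + psi)).
Proof.
revert j c psi. induction k as [|k IH]; intros j c psi;
  (split; [exists (Rabs c); intros a x Ha|]).
1, 3: assert (0 <= a ^ j <= 1) by
        (split; [apply pow_le; lra|rewrite <- (pow1 j); apply pow_incr; lra]);
      rewrite !Rabs_mult, (Rabs_pos_eq (a ^ j)) by easy;
      assert (Rabs (cos (x / 2 + psi)) <= 1) by (apply Rabs_le, COS_bound);
      assert (H1 := Rabs_pos (cos (x / 2 + psi))); assert (H2 := Rabs_pos c);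
      assert (a ^ j * Rabs c <= Rabs c) by nra;
      assert (0 <= a ^ j * Rabs c) by nra; nra.
- intros a x Ha. apply (ex_derive_continuous (V := R_NormedModule)). now auto_derive.
- exists (fun a x => a ^ S j * (c / 2) * cos (x / 2 + (psi + PI / 2))).
  split; [|apply IH].
  intros a x Ha. auto_derive; [easy|].
  rewrite (sin_cos (x * / 2 + psi)).
  replace (x / 2 + (psi + PI / 2)) with (PI / 2 + (x * / 2 + psi)) by (unfold Rdiv; ring).
  simpl. field. lra.
Qed.

Lemma zero_outside_Derive (f : R -> R) (b : R) :
  (forall t, b < Rabs t -> f t = 0) -> forall t, b < Rabs t -> Derive f t = 0.
Proof.
intros H t Ht. rewrite <- (Derive_const 0 t). apply Derive_ext_loc.
exists (mkposreal (Rabs t - b) ltac:(lra)). intros y Hy.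
change (Rabs (y - t) < Rabs t - b) in Hy.
change R in y. apply H. assert (H1 := Rabs_triang_inv t (t - y)).
rewrite <- (Rabs_Ropp (t - y)) in H1.
replace (- (t - y)) with (y - t) in H1 by ring.
replace (t - (t - y)) with y in H1 by ring. lra.
Qed.

Lemma continuous_zero_outside_bounded (f : R -> R) (b : R) : 0 <= b ->
  (forall t, continuous f t) -> (forall t, b < Rabs t -> f t = 0) ->
  exists B, forall t, Rabs (f t) <= B.
Proof.
intros Hb Hc H0.
destruct (continuity_ab_maj (fun x => Rabs (f x)) (- b) b) as [x0 [Hx0 _]]; [lra| |].
- intros c _. apply continuity_pt_filterlim.
  apply (continuous_comp f Rabs); [apply Hc|apply continuous_Rabs].
- exists (Rabs (f x0)). intros t. destruct (Rle_dec (Rabs t) b) as [Ht|Ht].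
  + apply Hx0. now apply Rabs_le_between.
  + rewrite H0 by lra. rewrite Rabs_R0. apply Rabs_pos.
Qed.

(** Vanishing outside a bounded set makes all derivatives of [f] bounded, and
    each application of the chain rule costs one factor [1 / a]. *)
Lemma scaled_comp (k : nat) (f : R -> R) (b : R) : 0 <= b ->
  smooth k f -> (forall t, b < Rabs t -> f t = 0) ->
  scaled k (fun a x => f (sin (x / 2) / a)).
Proof.
intros Hb. revert f. induction k as [|k IH]; intros f Hf H0;
  destruct (continuous_zero_outside_bounded f b Hb (smooth_continuous _ _ Hf) H0)
    as [B HB]; (split; [now exists B|]).
- intros a x Ha. apply (continuous_comp (fun x => sin (x / 2) / a) f); [|apply Hf].
  apply (ex_derive_continuous (V := R_NormedModule)). auto_derive. lra.
- destruct Hf as [Df Hf].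
  exists (fun a x => Derive f (sin (x / 2) / a) * (a ^ 0 * / 2 * cos (x / 2 + 0))).
  split.
  + intros a x Ha.
    replace (Derive f (sin (x / 2) / a) * (a ^ 0 * / 2 * cos (x / 2 + 0)) / a)
      with (/ 2 * cos (x / 2) / a * Derive f (sin (x / 2) / a))
      by (rewrite Rplus_0_r; simpl; field; lra).
    apply (is_derive_comp (K := R_AbsRing) (V := R_NormedModule) f
             (fun x => sin (x / 2) / a)).
    * now apply Derive_correct.
    * auto_derive; [lra|]. unfold Rdiv. ring.
  + apply scaled_mult; [|apply scaled_cos].
    apply IH; [exact Hf|now apply zero_outside_Derive].
Qed.

Lemma scaled_smooth (k : nat) (f : R -> R -> R) (a : R) :
  scaled k f -> 0 < a <= 1 -> smooth k (f a).
Proof.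
revert f. induction k as [|k IH]; intros f [_ Hf] Ha.
- intros x. now apply Hf.
- destruct Hf as [f' [Df Hf]]. apply smooth_S with (fun x => / a * f' a x).
  + intros x. rewrite Rmult_comm. now apply Df.
  + apply smooth_mult; [apply smooth_const|now apply IH].
Qed.

Lemma scaled_Derive_n (k : nat) (f : R -> R -> R) : scaled k f ->
  exists B, forall a x, 0 < a <= 1 -> Rabs (Derive_n (f a) k x) <= B / a ^ k.
Proof.
revert f. induction k as [|k IH]; intros f [[B HB] Hf].
- exists B. intros a x Ha. simpl. rewrite Rdiv_1_r. now apply HB.
- destruct Hf as [f' [Df Hf]]. destruct (IH f' Hf) as [B' HB'].
  exists B'. intros a x Ha. rewrite Derive_n_shift.
  rewrite (Derive_n_ext _ (fun x => / a * f' a x)).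
  2: { intros y. rewrite Rmult_comm. now apply is_derive_unique, Df. }
  rewrite Derive_n_scal_l, Rabs_mult, Rabs_pos_eq
    by (apply Rlt_le, Rinv_0_lt_compat; lra).
  replace (B' / a ^ S k) with (/ a * (B' / a ^ k))
    by (simpl; field; split; [apply pow_nonzero|]; lra).
  apply Rmult_le_compat_l; [apply Rlt_le, Rinv_0_lt_compat; lra|now apply HB'].
Qed.

(** * The polynomial and its flattening *)

(** A nondecreasing function of class [C^k] on the half-line [w >= 0], equal to
    [0] for [w <= 1] and to [w] for [w >= 2]: with [p = tpow (k + 1)], the factor
    [1 - p (1 - p (w - 1))] is a smooth step. *)
Definition ramp (k : nat) (w : R) : R := w * (1 - tpow (S k) (1 - tpow (S k) (w - 1))).

Lemma ramp_flat (k : nat) (w : R) : w <= 1 -> ramp k w = 0.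
Proof.
intros H. unfold ramp. rewrite (tpow_neg k (w - 1)), Rminus_0_r, tpow_one by lra. ring.
Qed.

Lemma ramp_incr (k : nat) (w1 w2 : R) : 0 <= w1 <= w2 -> ramp k w1 <= ramp k w2.
Proof.
intros H. unfold ramp. apply Rmult_le_compat; try lra.
- assert (tpow (S k) (1 - tpow (S k) (w1 - 1)) <= 1); [|lra].
  apply Rle_trans with (tpow (S k) 1); [apply tpow_incr|rewrite tpow_one; lra].
  assert (H0 := tpow_nonneg (S k) (w1 - 1)). lra.
- assert (tpow (S k) (1 - tpow (S k) (w2 - 1)) <= tpow (S k) (1 - tpow (S k) (w1 - 1)));
    [|lra].
  apply tpow_incr.
  assert (tpow (S k) (w1 - 1) <= tpow (S k) (w2 - 1)) by (apply tpow_incr; lra). lra.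
Qed.

(** The difference [w - ramp k w] at [w = t ^ (2 s)]. *)
Definition bump (k s : nat) (t : R) : R :=
  t ^ (2 * s) * tpow (S k) (1 - tpow (S k) (t ^ (2 * s) - 1)).

Lemma smooth_bump (k s : nat) : smooth k (bump k s).
Proof.
assert (Hp : smooth k (fun t => t ^ (2 * s))) by apply smooth_pow, smooth_id.
unfold bump. apply smooth_mult; [exact Hp|].
apply (smooth_comp k (tpow (S k)) (fun t => 1 - tpow (S k) (t ^ (2 * s) - 1)));
  [apply smooth_tpow|].
apply (smooth_ext k (fun t => 1 + (-1) * tpow (S k) (t ^ (2 * s) + (-1)))).
- intros t. replace (t ^ (2 * s) + -1) with (t ^ (2 * s) - 1) by ring. ring.
- apply smooth_plus; [apply smooth_const|].
  apply smooth_mult; [apply smooth_const|].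
  apply (smooth_comp k (tpow (S k)) (fun t => t ^ (2 * s) + (-1))); [apply smooth_tpow|].
  apply smooth_plus; [exact Hp|apply smooth_const].
Qed.

Lemma bump_outside (k s : nat) (t : R) : (1 <= s)%nat -> 2 < Rabs t -> bump k s t = 0.
Proof.
intros Hs Ht. unfold bump.
assert (H2 : 2 <= t ^ (2 * s)).
{ rewrite pow_mult, <- pow2_abs. apply Rle_trans with ((Rabs t ^ 2) ^ 1); [nra|].
  apply Rle_pow; [nra|exact Hs]. }
rewrite (tpow_neg k (1 - _)); [ring|].
(* The inner argument [1 - tpow] is nonpositive, so the outer power vanishes. *)
assert (tpow (S k) 1 <= tpow (S k) (t ^ (2 * s) - 1)) by (apply tpow_incr; lra).
rewrite tpow_one in H. lra.
Qed.

Definition model (s : nat) (x : R) : R := - sin (x / 2) ^ (2 * s).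

(** This form displays the distance to [model]; [flattened_ramp] gives the form
    in which the monotonicity is visible. *)
Definition flattened (k s : nat) (a x : R) : R :=
  model s x + a ^ (2 * s) * bump k s (sin (x / 2) / a).

Lemma trig_model (s : nat) : trig s (model s).
Proof.
assert (H : trig s (fun x => sin (x / 2) ^ (2 * s))).
{ induction s as [|s IH]; [exact (trig_const 0 1)|].
  (* [sin (x / 2) ^ 2 = (1 - cos x) / 2] raises the degree by one only. *)
  apply trig_ext with (fun x => / 2 * sin (x / 2) ^ (2 * s)
    + (- / 2) * (cos x * sin (x / 2) ^ (2 * s))).
  - intros x. replace (2 * S s)%nat with (2 + 2 * s)%nat by lia.
    rewrite pow_add. replace (cos x) with (1 - 2 * sin (x / 2) * sin (x / 2)).
    + simpl (sin (x / 2) ^ 2). field.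
    + rewrite <- cos_2a_sin. f_equal. field.
  - apply trig_lin; [apply trig_le with s; [lia|exact IH]|].
    now apply trig_mult_cos. }
apply trig_ext with (fun x => (-1) * sin (x / 2) ^ (2 * s) + 0 * sin (x / 2) ^ (2 * s)).
- intros x. unfold model. ring.
- now apply trig_lin.
Qed.

Lemma model_bounded (s : nat) (x : R) : Rabs (model s x) <= 1.
Proof.
unfold model. rewrite Rabs_Ropp, <- RPow_abs, <- (pow1 (2 * s)).
apply pow_incr. split; [apply Rabs_pos|apply Rabs_le, SIN_bound].
Qed.

Lemma even_pow_le (s : nat) (x y : R) : Rabs x <= Rabs y -> x ^ (2 * s) <= y ^ (2 * s).
Proof.
intros H. rewrite !pow_mult. apply pow_incr.
rewrite <- (pow2_abs x), <- (pow2_abs y). assert (H0 := Rabs_pos x). nra.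
Qed.

Lemma even_pow_nonneg (s : nat) (x : R) : 0 <= x ^ (2 * s).
Proof. rewrite pow_mult. apply pow_le, pow2_ge_0. Qed.

Lemma flattened_ramp (k s : nat) (a x : R) : 0 < a ->
  flattened k s a x = - (a ^ (2 * s) * ramp k ((sin (x / 2) / a) ^ (2 * s))).
Proof.
intros Ha. unfold flattened, model, ramp, bump.
set (p := tpow _ _). replace (sin (x / 2) ^ (2 * s))
  with (a ^ (2 * s) * (sin (x / 2) / a) ^ (2 * s)); [ring|].
rewrite <- Rpow_mult_distr. f_equal. field. lra.
Qed.

Lemma flattened_flat (k s : nat) (a x : R) : 0 < a -> Rabs (sin (x / 2)) <= a ->
  flattened k s a x = 0.
Proof.
intros Ha Hx. rewrite flattened_ramp, ramp_flat; [ring| |easy].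
rewrite <- (pow1 (2 * s)). apply even_pow_le.
rewrite Rabs_R1, Rabs_div, (Rabs_pos_eq a) by lra.
apply Rmult_le_reg_r with a; [easy|]. field_simplify; lra.
Qed.

Lemma flattened_antitone (k s : nat) (a x y : R) : 0 < a ->
  Rabs (sin (x / 2)) <= Rabs (sin (y / 2)) -> flattened k s a y <= flattened k s a x.
Proof.
intros Ha H. rewrite !flattened_ramp by easy. apply Ropp_le_contravar.
apply Rmult_le_compat_l; [apply pow_le; lra|]. apply ramp_incr.
split; [apply even_pow_nonneg|]. apply even_pow_le.
rewrite !Rabs_div by lra. apply Rmult_le_compat_r; [|easy].
apply Rlt_le, Rinv_0_lt_compat, Rabs_pos_lt. lra.
Qed.

Lemma flattened_periodic_Z (k s : nat) (a x : R) (q : Z) : 0 < a ->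
  flattened k s a (x + 2 * PI * IZR q) = flattened k s a x.
Proof.
intros Ha.
assert (H : Rabs (sin ((x + 2 * PI * IZR q) / 2)) = Rabs (sin (x / 2))).
{ replace ((x + 2 * PI * IZR q) / 2) with (x / 2 + IZR q * PI) by field.
  rewrite sin_plus, (sin_eq_0_1 (IZR q * PI)) by now exists q.
  rewrite Rmult_0_r, Rplus_0_r, Rabs_mult.
  assert (Hc : Rabs (cos (IZR q * PI)) = 1); [|rewrite Hc; ring].
  assert (H2 := sin2_cos2 (IZR q * PI)).
  rewrite (sin_eq_0_1 (IZR q * PI)), Rsqr_0, Rplus_0_l in H2 by now exists q.
  rewrite <- Rabs_R1. apply Rsqr_eq_abs_0. now rewrite H2, Rsqr_1. }
apply Rle_antisym; apply flattened_antitone; trivial; rewrite H; apply Rle_refl.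
Qed.

Lemma PI_gt_3 : 3 < PI.
Proof. assert (H := PI2_3_2). lra. Qed.

Lemma sin_half_lower (x : R) : 0 < x <= 1 -> x / 4 <= sin (x / 2).
Proof.
intros Hx. assert (HPI := PI_gt_3).
destruct (MVT_cor2 sin cos 0 (x / 2)) as [c [Hc Hc2]]; [lra| |].
- intros c _. apply derivable_pt_lim_sin.
- rewrite sin_0, !Rminus_0_r in Hc. rewrite Hc.
  assert (1 / 2 <= cos c); [|nra].
  rewrite <- cos_PI3. apply cos_decr_1; lra.
Qed.

Lemma sin_half_upper (x : R) : 0 <= x -> sin (x / 2) <= x / 2.
Proof.
intros [Hx|<-].
- apply Rlt_le, sin_lt_x. lra.
- rewrite Rdiv_0_l, sin_0. lra.
Qed.

(** To the left of [0] the function increases to its maximal value [0], which it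
    keeps up to [2 a], as [sin (x / 2) <= x / 2]. *)
Lemma flattened_increasing_left (k s : nat) (a u v : R) : 0 < a <= 1 ->
  - PI <= u -> u <= v -> v <= 2 * a -> flattened k s a u <= flattened k s a v.
Proof.
intros Ha H1 H2 H3. assert (HPI := PI_gt_3).
destruct (Rle_dec v 0) as [Hv|Hv].
- apply flattened_antitone; [lra|].
  rewrite <- (Rabs_Ropp (sin (v / 2))), <- (Rabs_Ropp (sin (u / 2))), <- !sin_neg.
  rewrite !Rabs_pos_eq by (apply sin_ge_0; lra).
  apply sin_incr_1; lra.
- assert (Hs : Rabs (sin (v / 2)) <= a).
  { assert (H := sin_half_upper v). rewrite Rabs_pos_eq by (apply sin_ge_0; lra). lra. }
  rewrite (flattened_flat k s a v) by lra.
  rewrite <- (flattened_flat k s a 0); try lra.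
  + apply flattened_antitone; [lra|]. rewrite Rdiv_0_l, sin_0, Rabs_R0. apply Rabs_pos.
  + rewrite Rdiv_0_l, sin_0, Rabs_R0. lra.
Qed.

Lemma flattened_decreasing_right (k s : nat) (a u v : R) : 0 < a ->
  0 <= u -> u <= v -> v <= PI -> flattened k s a v <= flattened k s a u.
Proof.
intros Ha H1 H2 H3. assert (HPI := PI_gt_3). apply flattened_antitone; [lra|].
rewrite !Rabs_pos_eq by (apply sin_ge_0; lra). apply sin_incr_1; lra.
Qed.

Lemma flattened_constant_middle (k s : nat) (a u v : R) : 0 < a <= 1 ->
  0 <= u -> u <= v -> v <= 2 * a -> flattened k s a u = flattened k s a v.
Proof.
intros Ha H1 H2 H3. assert (HPI := PI_gt_3).
apply Rle_antisym; [apply flattened_increasing_left|apply flattened_decreasing_right]; lra.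
Qed.

Lemma flattened_near_model (k s : nat) : (1 <= s)%nat -> exists B, 0 <= B /\
  forall a, 0 < a <= 1 ->
  smooth k (flattened k s a) /\
  (forall x, Rabs (flattened k s a x - model s x) <= a ^ (2 * s) * B) /\
  (forall x, Rabs (Derive_n (flattened k s a) k x - Derive_n (model s) k x)
             <= a ^ (2 * s) * (B / a ^ k)).
Proof.
intros Hs.
assert (HS := scaled_comp k (bump k s) 2 ltac:(lra) (smooth_bump k s)
                (fun t => bump_outside k s t Hs)).
destruct (scaled_bounded _ _ HS) as [B0 HB0].
destruct (scaled_Derive_n _ _ HS) as [B1 HB1].
assert (HQ : smooth k (model s)) by apply (smooth_trig k s), trig_model.
exists (Rmax 0 (Rmax B0 B1)). split; [apply Rmax_l|]. intros a Ha.
assert (Hpow : 0 <= a ^ (2 * s)) by (apply pow_le; lra).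
assert (M0 : B0 <= Rmax 0 (Rmax B0 B1)) by
  (eapply Rle_trans; [apply Rmax_l|apply Rmax_r]).
assert (M1 : B1 <= Rmax 0 (Rmax B0 B1)) by
  (eapply Rle_trans; [apply Rmax_r|apply Rmax_r]).
assert (Hb := scaled_smooth _ _ a HS Ha).
split; [|split].
- apply smooth_plus; [exact HQ|]. apply smooth_mult; [apply smooth_const|exact Hb].
- intros x. unfold flattened.
  replace (model s x + a ^ (2 * s) * bump k s (sin (x / 2) / a) - model s x)
    with (a ^ (2 * s) * bump k s (sin (x / 2) / a)) by ring.
  rewrite Rabs_mult, (Rabs_pos_eq (a ^ _)) by easy.
  apply Rmult_le_compat_l; [easy|]. eapply Rle_trans; [now apply HB0|easy].
- intros x. unfold flattened.
  rewrite (Derive_n_lin k (a ^ (2 * s)) (model s) (fun x => bump k s (sin (x / 2) / a)))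
    by easy.
  rewrite Rplus_comm. unfold Rminus. rewrite Rplus_assoc, Rplus_opp_r, Rplus_0_r.
  rewrite Rabs_mult, (Rabs_pos_eq (a ^ _)) by easy.
  apply Rmult_le_compat_l; [easy|]. eapply Rle_trans; [now apply HB1|].
  apply Rmult_le_compat_r; [|easy].
  apply Rlt_le, Rinv_0_lt_compat, pow_lt. lra.
Qed.

(** Each differentiation of [sin (x / 2) ^ (k + 1) * g x] lowers the power by one
    and multiplies the value at [0] of the cofactor by [(k + 1) / 2]. *)
Lemma Derive_n_sin_half_power (k : nat) (g : R -> R) : (forall j, smooth j g) -> g 0 <> 0 ->
  exists G, (forall j, smooth j G) /\ G 0 <> 0 /\
  forall x, Derive_n (fun x => sin (x / 2) ^ S k * g x) k x = sin (x / 2) * G x.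
Proof.
revert g. induction k as [|k IH]; intros g Hg Hg0.
- exists g. split; [exact Hg|split; [exact Hg0|]]. intros x. simpl. ring.
(* The induction runs on the cofactor that the first derivative leaves. *)
- destruct (IH (fun x => INR (S (S k)) / 2 * (cos (x / 2) * g x) + sin (x / 2) * Derive g x))
    as [G [HG [HG0 HD]]].
  + intros j. apply smooth_plus; apply smooth_mult.
    * apply smooth_const.
    * apply smooth_mult; [apply smooth_cos_half|apply Hg].
    * apply smooth_sin_half.
    * apply (Hg (S j)).
  + rewrite Rdiv_0_l, cos_0, sin_0, Rmult_0_l, Rplus_0_r, Rmult_1_l.
    apply Rmult_integral_contrapositive. split; [|exact Hg0].
    assert (H := lt_0_INR (S (S k)) (Nat.lt_0_succ _)). lra.
  + exists G. split; [exact HG|split; [exact HG0|]]. intros x.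
    rewrite Derive_n_shift, <- HD. apply Derive_n_ext. intros y.
    apply is_derive_unique.
    evar_last.
    * apply (is_derive_mult (K := R_AbsRing) (fun x => sin (x / 2) ^ S (S k)) g y).
      -- apply is_derive_pow with (l := cos (y / 2) / 2).
         auto_derive; [easy|]. unfold Rdiv. ring.
      -- apply Derive_correct, (Hg 1%nat).
      -- exact Rmult_comm.
    * unfold plus, mult; simpl pred; simpl pow; simpl.
      change (match k with 0%nat => 1 | S _ => INR k + 1 end + 1) with (INR (S (S k))).
      field.
Qed.

Lemma model_Derive_n_lower (s : nat) : (1 <= s)%nat -> exists c b, 0 < c /\ 0 < b /\
  forall x, 0 < x <= b -> c * x <= Rabs (Derive_n (model s) (2 * s - 1) x).
Proof.
intros Hs.
destruct (Derive_n_sin_half_power (2 * s - 1) (fun _ => -1)) as [G [HG [HG0 HD]]].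
- intros j. apply smooth_const.
- lra.
- assert (HG0' := Rabs_pos_lt _ HG0).
  assert (Hcont := HG 0%nat 0). apply continuity_pt_filterlim in Hcont.
  destruct (Hcont (Rabs (G 0) / 2)) as [d [Hd Hcl]]; [lra|].
  exists (Rabs (G 0) / 8), (Rmin 1 (d / 2)).
  split; [lra|]. split; [apply Rmin_pos; lra|].
  intros x Hx. assert (H1 := Rmin_l 1 (d / 2)). assert (H2 := Rmin_r 1 (d / 2)).
  rewrite (Derive_n_ext _ (fun x => sin (x / 2) ^ S (2 * s - 1) * -1)).
  + rewrite HD, Rabs_mult.
    assert (H3 := sin_half_lower x). rewrite (Rabs_pos_eq (sin _)) by lra.
    assert (Rabs (G 0) / 2 <= Rabs (G x)).
    { assert (H4 : Rabs (G x - G 0) < Rabs (G 0) / 2).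
      { apply Hcl. split; [split; [exact I|lra]|]. simpl. unfold R_dist.
        rewrite Rminus_0_r, Rabs_pos_eq; lra. }
      assert (H5 := Rabs_triang_inv (G 0) (G x)).
      rewrite (Rabs_minus_sym (G 0)) in H5. lra. }
    nra.
  + intros t. unfold model. replace (S (2 * s - 1)) with (2 * s)%nat by lia. ring.
Qed.

(** * The clustered collection *)

(** The points in one period, indexed by [0 <= j < 2 s]: the first [2 s - 1] are
    equally spaced in [[a, 2 a]], the last one is [PI]. *)
Definition node (s : nat) (a : R) (j : Z) : R :=
  if (j =? 2 * Z.of_nat s - 1)%Z then PI else a * (1 + IZR j / (2 * INR s)).

(** Indices are shifted by one so that the cluster consists of the points number
    [1] to [2 s - 1]; point number [0] is then [- PI], and the sign [(-1) ^ (i - 1)]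
    of the first interval [[- PI, a]] is positive. *)
Definition cluster_pt (s : nat) (a : R) (i : Z) : R :=
  node s a ((i - 1) mod (2 * Z.of_nat s)) + 2 * PI * IZR ((i - 1) / (2 * Z.of_nat s)).

Lemma cluster_pt_eq (s : nat) (a : R) (q j : Z) :
  (0 <= j < 2 * Z.of_nat s)%Z ->
  cluster_pt s a (2 * Z.of_nat s * q + j + 1) = node s a j + 2 * PI * IZR q.
Proof.
intros Hj. unfold cluster_pt.
replace (2 * Z.of_nat s * q + j + 1 - 1)%Z with (2 * Z.of_nat s * q + j)%Z by ring.
rewrite <- (Z.mod_unique_pos (2 * Z.of_nat s * q + j) (2 * Z.of_nat s) q j)  by (trivial; ring).
rewrite <- (Z.div_unique_pos (2 * Z.of_nat s * q + j) (2 * Z.of_nat s) q j)  by (trivial; ring).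
reflexivity.
Qed.

Lemma node_cluster (s : nat) (a : R) (j : Z) : (1 <= s)%nat -> 0 < a ->
  (0 <= j < 2 * Z.of_nat s - 1)%Z -> a <= node s a j < 2 * a.
Proof.
intros Hs Ha Hj. unfold node. destruct (Z.eqb_spec j (2 * Z.of_nat s - 1)); [lia|].
assert (H0 : 0 < 2 * INR s) by (assert (H := lt_0_INR s Hs); lra).
assert (H1 : 0 <= IZR j / (2 * INR s) < 1).
{ split.
  - apply Rmult_le_pos; [apply IZR_le; lia|apply Rlt_le, Rinv_0_lt_compat, H0].
  - apply Rmult_lt_reg_r with (2 * INR s); [exact H0|]. unfold Rdiv.
    rewrite Rmult_assoc, Rinv_l, Rmult_1_r, Rmult_1_l, INR_IZR_INZ, <- mult_IZR by lra.
    apply IZR_lt. lia. }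
nra.
Qed.

Lemma node_last (s : nat) (a : R) : node s a (2 * Z.of_nat s - 1) = PI.
Proof. unfold node. now rewrite Z.eqb_refl. Qed.

Lemma node_incr (s : nat) (a : R) (j : Z) : (1 <= s)%nat -> 0 < a <= 1 ->
  (0 <= j < 2 * Z.of_nat s - 1)%Z -> node s a j < node s a (j + 1).
Proof.
intros Hs Ha Hj. assert (HPI := PI_gt_3).
assert (H1 := node_cluster s a j Hs (proj1 Ha) Hj).
destruct (Z.eq_dec (j + 1) (2 * Z.of_nat s - 1)) as [He|He].
- rewrite He, node_last. lra.
- unfold node. destruct (Z.eqb_spec j (2 * Z.of_nat s - 1)); [lia|].
  destruct (Z.eqb_spec (j + 1) (2 * Z.of_nat s - 1)); [lia|].
  apply Rmult_lt_compat_l; [lra|]. apply Rplus_lt_compat_l.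
  apply Rmult_lt_compat_r.
  + apply Rinv_0_lt_compat. assert (H := lt_0_INR s Hs). lra.
  + apply IZR_lt. lia.
Qed.

Lemma index_decompose (s : nat) (i : Z) : (1 <= s)%nat ->
  exists q j, (0 <= j < 2 * Z.of_nat s)%Z /\ i = (2 * Z.of_nat s * q + j + 1)%Z.
Proof.
intros Hs. exists ((i - 1) / (2 * Z.of_nat s))%Z, ((i - 1) mod (2 * Z.of_nat s))%Z.
split; [apply Z.mod_pos_bound; lia|].
assert (H := Z.div_mod (i - 1) (2 * Z.of_nat s)). lia.
Qed.

Lemma cluster_pt_period (s : nat) (a : R) (i : Z) : (1 <= s)%nat ->
  cluster_pt s a (i + 2 * Z.of_nat s) = cluster_pt s a i + 2 * PI.
Proof.
intros Hs. destruct (index_decompose s i Hs) as [q [j [Hj ->]]].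
replace (2 * Z.of_nat s * q + j + 1 + 2 * Z.of_nat s)%Z
  with (2 * Z.of_nat s * (q + 1) + j + 1)%Z by ring.
rewrite !cluster_pt_eq, plus_IZR by easy. ring.
Qed.

Lemma cluster_pt_pred (s : nat) (a : R) (q j : Z) : (1 <= s)%nat ->
  (0 <= j < 2 * Z.of_nat s)%Z ->
  cluster_pt s a (2 * Z.of_nat s * q + j + 1 - 1) =
  (if (j =? 0)%Z then - PI else node s a (j - 1)) + 2 * PI * IZR q.
Proof.
intros Hs Hj. destruct (Z.eqb_spec j 0) as [->|Hne].
- replace (2 * Z.of_nat s * q + 0 + 1 - 1)%Z
    with (2 * Z.of_nat s * (q - 1) + (2 * Z.of_nat s - 1) + 1)%Z by ring.
  rewrite cluster_pt_eq, node_last, minus_IZR by lia. ring.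
- replace (2 * Z.of_nat s * q + j + 1 - 1)%Z
    with (2 * Z.of_nat s * q + (j - 1) + 1)%Z by ring.
  rewrite cluster_pt_eq by lia. reflexivity.
Qed.

Lemma cluster_pt_incr (s : nat) (a : R) (i : Z) : (1 <= s)%nat -> 0 < a <= 1 ->
  cluster_pt s a i < cluster_pt s a (i + 1).
Proof.
intros Hs Ha. assert (HPI := PI_gt_3).
destruct (index_decompose s (i + 1) Hs) as [q [j [Hj Hi]]].
replace i with (i + 1 - 1)%Z by ring. rewrite Hi, cluster_pt_pred by easy.
replace (2 * Z.of_nat s * q + j + 1 - 1 + 1)%Z
  with (2 * Z.of_nat s * q + j + 1)%Z by ring.
rewrite cluster_pt_eq by easy. apply Rplus_lt_compat_r.
destruct (Z.eqb_spec j 0) as [->|Hne].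
- assert (H := node_cluster s a 0 Hs (proj1 Ha)). assert (a <= node s a 0); [|lra].
  apply H. lia.
- assert (H := node_incr s a (j - 1) Hs Ha).
  replace (j - 1 + 1)%Z with j in H by ring. apply H. lia.
Qed.

Definition cluster (s : nat) (a : R) (Hs : (1 <= s)%nat) (Ha : 0 < a <= 1) : collection s :=
  Collection s (cluster_pt s a) (fun i => cluster_pt_incr s a i Hs Ha)
             (fun i => cluster_pt_period s a i Hs).

Lemma powerRZ_parity (j m : Z) : powerRZ (-1) (2 * m + j) = powerRZ (-1) j.
Proof.
rewrite powerRZ_add by lra. replace (2 * m)%Z with (m + m)%Z by ring.
rewrite powerRZ_add, <- powerRZ_mult by lra.
replace (-1 * -1) with 1 by ring. rewrite powerRZ_R1. ring.
Qed.

(** Of the intervals in one period only [[- PI, a]] and the one ending at [PI]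
    matter: all the others lie in [[a, 2 a]], where the function is constant. *)
Lemma flattened_comonotone (k s : nat) (a : R) (Hs : (1 <= s)%nat) (Ha : 0 < a <= 1) :
  Cper (flattened k s a) -> Delta1 (cluster s a Hs Ha) (flattened k s a).
Proof.
intros HC. split; [exact HC|]. intros i u v Hu Huv Hv.
assert (HPI := PI_gt_3).
simpl in Hu, Hv. destruct (index_decompose s i Hs) as [q [j [Hj ->]]].
rewrite cluster_pt_pred in Hu by easy. rewrite cluster_pt_eq in Hv by easy.
replace (2 * Z.of_nat s * q + j + 1 - 1)%Z
  with (2 * (Z.of_nat s * q) + j)%Z by ring.
rewrite powerRZ_parity.
replace u with (u - 2 * PI * IZR q + 2 * PI * IZR q) by ring.
replace v with (v - 2 * PI * IZR q + 2 * PI * IZR q) by ring.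
rewrite !flattened_periodic_Z by lra.
set (u' := u - 2 * PI * IZR q). set (v' := v - 2 * PI * IZR q).
destruct (Z.eqb_spec j 0) as [Hj0|Hne].
- subst j. simpl. rewrite !Rmult_1_l.
  assert (a <= node s a 0 < 2 * a) by (apply node_cluster; [easy|lra|lia]).
  apply flattened_increasing_left; unfold u', v'; lra.
- assert (H1 : a <= node s a (j - 1) < 2 * a) by (apply node_cluster; [easy|lra|lia]).
  destruct (Z.eq_dec j (2 * Z.of_nat s - 1)) as [->|Hl].
  + rewrite node_last in Hv.
    replace (2 * Z.of_nat s - 1)%Z with (2 * (Z.of_nat s - 1) + 1)%Z by ring.
    rewrite powerRZ_parity. simpl.
    assert (flattened k s a v' <= flattened k s a u'); [|lra].
    apply flattened_decreasing_right; unfold u', v'; lra.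
  + assert (H2 : a <= node s a j < 2 * a) by (apply node_cluster; [easy|lra|lia]).
    right. f_equal. apply flattened_constant_middle; unfold u', v'; lra.
Qed.

(** * Zeros of derivatives of comonotone polynomials *)

(** Up to a sign, [Y i] is a local maximum. *)
Lemma comonotone_Derive_zero (s : nat) (Y : collection s) (T : R -> R) (i : Z) :
  Delta1 Y T -> ex_derive T (Y i) -> Derive T (Y i) = 0.
Proof.
intros [_ HT] HD.
assert (H1 := pt_incr s Y (i - 1)). assert (H2 := pt_incr s Y i).
replace (i - 1 + 1)%Z with i in H1 by ring.
set (e := powerRZ (-1) (i - 1)).
assert (He : e = 1 \/ e = -1).
{ destruct (Zeven_odd_dec (i - 1)) as [Hi|Hi]; unfold e.
  - left. destruct (Zeven_ex _ Hi) as [m ->].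
    rewrite <- (Z.add_0_r (2 * m)), powerRZ_parity. reflexivity.
  - right. destruct (Zodd_ex _ Hi) as [m ->]. rewrite powerRZ_parity. simpl. ring. }
assert (He' : powerRZ (-1) (i + 1 - 1) = - e).
{ replace (i + 1 - 1)%Z with ((i - 1) + 1)%Z by ring.
  rewrite powerRZ_add by lra. fold e. simpl. ring. }
assert (Hmax : forall x, Y (i - 1)%Z < x -> x < Y (i + 1)%Z -> e * T x <= e * T (Y i)).
{ intros x Hx1 Hx2. destruct (Rle_dec x (Y i)) as [Hx|Hx].
  - apply (HT i x (Y i)); lra.
  - assert (H := HT (i + 1)%Z (Y i) x). rewrite He' in H.
    replace (i + 1 - 1)%Z with i in H by ring.
    assert (- e * T (Y i) <= - e * T x) by (apply H; lra). lra. }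
assert (Hd : derivable_pt_lim (fun x => e * T x) (Y i) (e * Derive T (Y i))).
{ apply is_derive_Reals, is_derive_scal, Derive_correct, HD. }
assert (H := deriv_maximum (fun x => e * T x) (Y (i - 1)%Z) (Y (i + 1)%Z) (Y i)
  (exist _ _ Hd) H1 H2 Hmax).
simpl in H. destruct He as [He|He]; rewrite He in H; lra.
Qed.

Lemma Rolle_Derive_n (k : nat) (f : R -> R) (z : nat -> R) : smooth k f ->
  (forall i, (i < k)%nat -> z i < z (S i)) ->
  (forall i, (i <= k)%nat -> f (z i) = 0) ->
  exists xi, z 0%nat <= xi <= z k /\ Derive_n f k xi = 0.
Proof.
revert f z. induction k as [|k IH]; intros f z Hf Hz H0.
- exists (z 0%nat). split; [lra|]. now apply H0.
- assert (Hw : forall i, exists w, (i <= k)%nat -> z i < w < z (S i) /\ Derive f w = 0).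
  { intros i. destruct (le_dec i k) as [Hi|Hi]; [|exists 0; lia].
    destruct (MVT_cor2 f (Derive f) (z i) (z (S i))) as [c [Hc Hc2]].
    - apply Hz. lia.
    - intros c _. apply is_derive_Reals, Derive_correct, (proj1 Hf).
    - exists c. intros _. split; [exact Hc2|].
      rewrite !H0 in Hc by lia. assert (H1 := Hz i ltac:(lia)).
      assert (H2 : Derive f c * (z (S i) - z i) = 0) by lra.
      apply Rmult_integral in H2. destruct H2; lra. }
  (* Outside the range [i <= k] the values of [w] are arbitrary. *)
  pose (w := fun i => proj1_sig (constructive_indefinite_description _ (Hw i))).
  assert (Hw' : forall i, (i <= k)%nat -> z i < w i < z (S i) /\ Derive f (w i) = 0)
    by (intros i; exact (proj2_sig (constructive_indefinite_description _ (Hw i)))).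
  destruct (IH (Derive f) w (proj2 Hf)) as [xi [Hxi HD]].
  + intros i Hi. assert (H1 := Hw' i ltac:(lia)). assert (H2 := Hw' (S i) ltac:(lia)). lra.
  + intros i Hi. now apply Hw'.
  + exists xi. split.
    * assert (H1 := Hw' 0%nat ltac:(lia)). assert (H2 := Hw' k ltac:(lia)). lra.
    * now rewrite Derive_n_shift.
Qed.

(** Rolle's theorem applied to the [2 s - 1] zeros of [T'] in the cluster. *)
Lemma comonotone_trig_flat (s : nat) (a : R) (Hs : (1 <= s)%nat) (Ha : 0 < a <= 1)
  (m : nat) (T : R -> R) : trig m T -> Delta1 (cluster s a Hs Ha) T ->
  exists xi, a <= xi <= 2 * a /\ Derive_n T (2 * s - 1) xi = 0.
Proof.
intros HT HD.
assert (Hpt : forall i, (i <= 2 * s - 2)%nat ->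
  cluster_pt s a (Z.of_nat i + 1) = node s a (Z.of_nat i)).
{ intros i Hi. assert (H := cluster_pt_eq s a 0 (Z.of_nat i) ltac:(lia)).
  rewrite Z.mul_0_r, Z.add_0_l in H. rewrite H. ring. }
destruct (Rolle_Derive_n (2 * s - 2) (Derive T)
  (fun i => cluster s a Hs Ha (Z.of_nat i + 1)%Z)) as [xi [Hxi H0]].
- exact (proj2 (smooth_trig (S (2 * s - 2)) m T HT)).
- intros i Hi. rewrite Nat2Z.inj_succ.
  replace (Z.succ (Z.of_nat i) + 1)%Z with (Z.of_nat i + 1 + 1)%Z by lia.
  apply pt_incr.
- intros i Hi. apply comonotone_Derive_zero; [exact HD|].
  apply (proj1 (smooth_trig 1 m T HT)).
- exists xi. split.
  + change (cluster_pt s a (Z.of_nat 0 + 1) <= xi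
            <= cluster_pt s a (Z.of_nat (2 * s - 2) + 1)) in Hxi.
    rewrite !Hpt in Hxi by lia.
    assert (H1 := node_cluster s a (Z.of_nat 0) Hs (proj1 Ha) ltac:(lia)).
    assert (H2 := node_cluster s a (Z.of_nat (2 * s - 2)) Hs (proj1 Ha) ltac:(lia)). lra.
  + replace (2 * s - 1)%nat with (S (2 * s - 2)) by lia. now rewrite Derive_n_shift.
Qed.

(** * Lower bound for the error and upper bound for the modulus *)

Lemma Cper_minus (f g : R -> R) : Cper f -> Cper g -> Cper (fun x => f x - g x).
Proof.
intros [Hf Pf] [Hg Pg]. split.
- intros x. apply (continuous_minus (V := R_NormedModule)); auto.
- intros x. now rewrite Pf, Pg.
Qed.

(** At the point [xi] of [comonotone_trig_flat] the derivative of order [2 s - 1] of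
    [model - T] is that of [model], which is at least [c * a]; Bernstein's
    inequality turns this into a lower bound for the norm of [model - T]. *)
Lemma En1_lower (s n : nat) (B c b : R) (a : R) (Hs : (1 <= s)%nat) (Ha : 0 < a <= 1) (F : R -> R) :
  (1 <= n)%nat ->
  (forall x, 0 < x <= b -> c * x <= Rabs (Derive_n (model s) (2 * s - 1) x)) ->
  2 * a <= b -> 0 <= c -> Cper F ->
  (forall x, Rabs (F x - model s x) <= a ^ (2 * s) * B) ->
  c * a / (2 * INR (S (n + s))) ^ (2 * s - 1) - a ^ (2 * s) * B
    <= En1 n F (cluster s a Hs Ha).
Proof.
intros Hn HQ Hab Hc HF HFQ.
apply (proj2 (En1_glb s n F (cluster s a Hs Ha) Hn HF)). intros T HT HD.
apply trigpoly_trig in HT.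
destruct (comonotone_trig_flat s a Hs Ha n T HT HD) as [xi [Hxi H0]].
destruct (supnorm_max _ (Cper_minus F T HF (proj1 HD))) as [_ [_ Hsup]].
set (E := supnorm (fun x => F x - T x)) in *.
set (L := 2 * INR (S (n + s))).
assert (HL : 0 < L ^ (2 * s - 1)).
{ apply pow_lt. unfold L. assert (H := lt_0_INR (S (n + s)) (Nat.lt_0_succ _)). lra. }
assert (Htr : trig (n + s) (fun x => model s x + -1 * T x)).
{ apply trig_ext with (fun x => 1 * model s x + -1 * T x); [intros x; ring|].
  apply trig_lin; [apply trig_le with s|apply trig_le with n]; trivial;
    [lia|apply trig_model|lia]. }
assert (HB := bernstein_n (n + s) (2 * s - 1) _ (E + a ^ (2 * s) * B) Htr).
fold L in HB.
assert (HDn : Rabs (Derive_n (model s) (2 * s - 1) xi) <= L ^ (2 * s - 1) * (E + a ^ (2 * s) * B)).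
{ replace (Derive_n (model s) (2 * s - 1) xi)
    with (Derive_n (fun x => model s x + -1 * T x) (2 * s - 1) xi).
  - apply HB. intros x.
    replace (model s x + -1 * T x) with (F x - T x + - (F x - model s x)) by ring.
    eapply Rle_trans; [apply Rabs_triang|]. rewrite Rabs_Ropp.
    apply Rplus_le_compat; [apply Hsup|apply HFQ].
  - rewrite (Derive_n_lin _ (-1) (model s) T), H0; [ring| |].
    + apply (smooth_trig _ s), trig_model.
    + now apply (smooth_trig _ n). }
assert (H1 : c * a <= L ^ (2 * s - 1) * (E + a ^ (2 * s) * B)).
{ apply Rle_trans with (c * xi); [apply Rmult_le_compat_l; lra|].
  eapply Rle_trans; [apply HQ; lra|exact HDn]. }
assert (H2 : c * a / L ^ (2 * s - 1) <= E + a ^ (2 * s) * B); [|lra].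
apply Rmult_le_reg_r with (L ^ (2 * s - 1)); [exact HL|].
unfold Rdiv. rewrite Rmult_assoc, Rinv_l by lra. lra.
Qed.

Lemma omega_nonneg (k : nat) (g : R -> R) (t : R) : Cper g -> 0 < t -> 0 <= omega k g t.
Proof.
intros Hg Ht.
destruct (supnorm_max _ (Cper_fdiff k t g Hg)) as [x [Hx _]].
apply Rle_trans with (supnorm (fdiff k t g)); [rewrite Hx; apply Rabs_pos|].
apply (omega_lub k g t Hg Ht). exists t. split; [lra|reflexivity].
Qed.

(** The choice [a = kap / n ^ (3/2)] balances the two contributions [n ^ (-3)] and
    [a ^ 2] to the modulus; a larger [a] would increase the modulus, a smaller
    one would decrease the error. *)
Lemma sqrt_n_gap (s r : nat) : (1 <= s)%nat -> r = (2 * s - 2)%nat ->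
  exists c : R, 0 < c /\
    forall n : nat, (1 <= n)%nat ->
    exists (Y : collection s) (F : R -> R),
      Cr r F /\ Delta1 Y F /\
      En1 n F Y > sqrt (INR n) * (c / INR n ^ r) * omega 3 (Derive_n F r) (1 / INR n).
Proof.
intros Hs Hr.
destruct (model_Derive_n_lower s Hs) as [c0 [b [Hc0 [Hb HQ]]]].
destruct (flattened_near_model r s Hs) as [B [HB HF]].
assert (Hs1 : 1 <= INR s) by (apply (le_INR 1); exact Hs).
set (K := (2 * (INR s + 2)) ^ (2 * s - 1)).
assert (HK : 0 < K) by (apply pow_lt; lra).
set (W := (2 * INR (S s)) ^ 3 * (2 * INR (S s)) ^ r + 8 * B).
assert (HW : 0 < W).
{ assert (0 < 2 * INR (S s)) by (rewrite S_INR; lra).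
  assert (0 < (2 * INR (S s)) ^ 3 * (2 * INR (S s)) ^ r)
    by (apply Rmult_lt_0_compat; now apply pow_lt).
  unfold W. lra. }
(* [kap] has to be small enough for the cluster to lie where the lower bound
   for the derivative holds, and for the term [a ^ (2 s) * B] to be absorbed. *)
set (kap := Rmin 1 (Rmin (b / 2) (c0 / (2 * K * (B + 1))))).
assert (HKB : 0 < 2 * K * (B + 1)) by (apply Rmult_lt_0_compat; lra).
assert (Hk1 : kap <= 1) by apply Rmin_l.
assert (Hk2 : kap <= b / 2) by (eapply Rle_trans; [apply Rmin_r|apply Rmin_l]).
assert (Hk3 : K * B * kap <= c0 / 2).
{ assert (H : kap <= c0 / (2 * K * (B + 1)))
    by (eapply Rle_trans; [apply Rmin_r|apply Rmin_r]).
  assert (Hk0 : 0 <= K * (B + 1)) by nra.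
  assert (Hm := Rmult_le_compat_l _ _ _ Hk0 H).
  replace (K * (B + 1) * (c0 / (2 * K * (B + 1)))) with (c0 / 2) in Hm by (field; lra).
  assert (0 < kap).
  { repeat apply Rmin_pos; try lra. now apply Rdiv_lt_0_compat. }
  nra. }
assert (Hk0 : 0 < kap).
{ repeat apply Rmin_pos; try lra. now apply Rdiv_lt_0_compat. }
clearbody kap.
exists (c0 * kap / (4 * K * W)).
split; [apply Rdiv_lt_0_compat; [nra|apply Rmult_lt_0_compat; lra]|].
intros n Hn.
assert (Hn1 : 1 <= INR n) by (apply (le_INR 1); exact Hn).
set (N := INR n) in *.
assert (HN : 0 < sqrt N) by (apply sqrt_lt_R0; lra).
assert (HNN : sqrt N * sqrt N = N) by (apply sqrt_sqrt; lra).
assert (HN1 : 1 <= sqrt N) by (rewrite <- sqrt_1; apply sqrt_le_1_alt; exact Hn1).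
set (a := kap / (N * sqrt N)).
assert (Hden : 1 <= N * sqrt N) by nra.
assert (HaN : a * (N * sqrt N) = kap) by (unfold a; field; split; lra).
assert (Ha0 : 0 < a) by (apply Rdiv_lt_0_compat; lra).
assert (HNa : N * a <= kap) by (rewrite <- HaN; nra).
assert (Hak : a <= kap) by nra.
assert (Ha : 0 < a <= 1) by lra.
destruct (HF a Ha) as [HFs [HF0 HFr]].
assert (HFC : Cr r (flattened r s a)).
{ apply smooth_Cr; [exact HFs|]. intros x.
  rewrite <- (flattened_periodic_Z r s a x 1 Ha0). f_equal. ring. }
exists (cluster s a Hs Ha), (flattened r s a).
split; [exact HFC|split; [apply flattened_comonotone, HFC|]].
assert (HE := En1_lower s n B c0 b a Hs Ha (flattened r s a) Hn HQ ltac:(lra)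
  ltac:(lra) (proj1 HFC) HF0).
assert (Hpn : 0 < N ^ (2 * s - 1)) by (apply pow_lt; lra).
assert (HL : (2 * INR (S (n + s))) ^ (2 * s - 1) <= K * N ^ (2 * s - 1)).
{ unfold K. rewrite <- Rpow_mult_distr. apply pow_incr.
  rewrite S_INR, plus_INR. fold N. nra. }
assert (HL0 : 0 < (2 * INR (S (n + s))) ^ (2 * s - 1)).
{ apply pow_lt. assert (H := lt_0_INR (S (n + s)) (Nat.lt_0_succ _)). lra. }
(* The flattening costs at most half of the lower bound, because
   [(n * a) ^ (2 s - 1) <= n * a <= kap]. *)
assert (HE1 : c0 * a / (2 * (K * N ^ (2 * s - 1))) <= En1 n (flattened r s a) (cluster s a Hs Ha)).
{ eapply Rle_trans; [|exact HE].
  assert (H1 : c0 * a / (K * N ^ (2 * s - 1)) <= c0 * a / (2 * INR (S (n + s))) ^ (2 * s - 1)).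
  { apply Rmult_le_compat_l; [nra|]. now apply Rinv_le_contravar. }
  assert (H2 : a ^ (2 * s) * B <= c0 * a / (2 * (K * N ^ (2 * s - 1)))).
  { apply Rmult_le_reg_r with (K * N ^ (2 * s - 1)); [now apply Rmult_lt_0_compat|].
    replace (c0 * a / (2 * (K * N ^ (2 * s - 1))) * (K * N ^ (2 * s - 1)))
      with (c0 / 2 * a) by (field; lra).
    replace (2 * s)%nat with (S (2 * s - 1)) at 1 by lia.
    replace (a ^ S (2 * s - 1) * B * (K * N ^ (2 * s - 1)))
      with (K * B * (N * a) ^ (2 * s - 1) * a)
      by (rewrite Rpow_mult_distr; simpl; ring).
    apply Rmult_le_compat_r; [lra|]. eapply Rle_trans; [|exact Hk3].
    apply Rmult_le_compat_l; [nra|].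
    replace (2 * s - 1)%nat with (S (2 * s - 2)) by lia. simpl pow.
    assert (H3 : (N * a) ^ (2 * s - 2) <= 1).
    { rewrite <- (pow1 (2 * s - 2)). apply pow_incr. nra. }
    assert (H4 : 0 <= (N * a) ^ (2 * s - 2)) by (apply pow_le; nra).
    apply Rle_trans with (N * a * 1); [|lra].
    apply Rmult_le_compat_l; [nra|exact H3]. }
  replace (c0 * a / (2 * (K * N ^ (2 * s - 1))))
    with (c0 * a / (K * N ^ (2 * s - 1)) - c0 * a / (2 * (K * N ^ (2 * s - 1))))
    by (field; lra).
  lra. }
assert (Hom : omega 3 (Derive_n (flattened r s a) r) (1 / N) <= W / N ^ 3).
{ eapply Rle_trans.
  - apply (omega3_le s ((2 * INR (S s)) ^ r) (a ^ (2 * s) * (B / a ^ r)) (1 / N)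
      (Derive_n (flattened r s a) r) (Derive_n (model s) r)
      (fun x => Derive_n (flattened r s a) r x - Derive_n (model s) r x)).
    + now apply Cper_Derive_n.
    + apply Rdiv_lt_0_compat; lra.
    + intros x. ring.
    + apply trig_Derive_n, trig_model.
    + intros x. rewrite <- (Rmult_1_r (_ ^ r)).
      apply bernstein_n; [apply trig_model|apply model_bounded].
    + exact HFr.
  - replace (a ^ (2 * s) * (B / a ^ r)) with (B * a ^ 2).
    2: { replace (2 * s)%nat with (2 + r)%nat by lia. rewrite pow_add. field.
         apply pow_nonzero. lra. }
    assert (Ha2 : a ^ 2 = kap ^ 2 / N ^ 3).
    { rewrite <- HaN. replace (N ^ 3) with (N ^ 2 * (sqrt N * sqrt N)) by (rewrite HNN; ring).
      field. split; lra. }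
    assert (HN3 : 0 < N ^ 3) by (apply pow_lt; lra).
    rewrite Ha2.
    replace ((2 * INR (S s) * (1 / N)) ^ 3 * (2 * INR (S s)) ^ r + 8 * (B * (kap ^ 2 / N ^ 3)))
      with (((2 * INR (S s)) ^ 3 * (2 * INR (S s)) ^ r + 8 * (B * kap ^ 2)) / N ^ 3)
      by (field; lra).
    apply Rmult_le_compat_r; [apply Rlt_le, Rinv_0_lt_compat, HN3|].
    unfold W. apply Rplus_le_compat_l. assert (kap ^ 2 <= 1) by nra. nra. }
apply Rlt_gt. eapply Rlt_le_trans; [|exact HE1].
assert (Hpr : 0 < N ^ r) by (apply pow_lt; lra).
eapply Rle_lt_trans.
- apply Rmult_le_compat_l; [|exact Hom].
  apply Rmult_le_pos; [lra|]. apply Rlt_le, Rdiv_lt_0_compat; [|exact Hpr].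
  apply Rdiv_lt_0_compat; nra.
- replace (2 * s - 1)%nat with (S r) by lia.
  replace (c0 * a / (2 * (K * N ^ S r))) with
    (2 * (sqrt N * (c0 * kap / (4 * K * W) / N ^ r) * (W / N ^ 3))).
  + assert (0 < sqrt N * (c0 * kap / (4 * K * W) / N ^ r) * (W / N ^ 3)); [|lra].
    repeat apply Rmult_lt_0_compat; try lra; try apply Rinv_0_lt_compat;
      repeat apply Rmult_lt_0_compat; try lra.
  + assert (Hid : forall q p, 0 < q -> 0 < p ->
      2 * (q * (c0 * kap / (4 * K * W) / p) * (W / (q * q) ^ 3)) =
      c0 * (kap / (q * q * q)) / (2 * (K * (q * q * p)))) by (intros; field; lra).
    specialize (Hid (sqrt N) (N ^ r) HN Hpr). rewrite HNN in Hid. exact Hid.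
Qed.

Theorem theorem2p2 :
  forall s r : nat, (1 <= s)%nat -> r = (2 * s - 2)%nat ->
  (exists c : R, 0 < c /\
    forall n : nat, (1 <= n)%nat ->
    exists (Y : collection s) (F : R -> R),
      Cr r F /\ Delta1 Y F /\
      En1 n F Y > sqrt (INR n) * (c / INR n ^ r) * omega 3 (Derive_n F r) (1 / INR n))
  /\
  (forall A N : R, 0 < A -> 0 < N ->
    exists (n : nat) (Y : collection s) (F : R -> R),
      INR n > N /\ Cr r F /\ Delta1 Y F /\
      En1 n F Y > A / INR n ^ r * omega 3 (Derive_n F r) (1 / INR n)).
Proof.
intros s r Hs Hr. assert (Hgap := sqrt_n_gap s r Hs Hr). split; [exact Hgap|].
destruct Hgap as [c [Hc Hgap]]. intros A N HA HN.
destruct (INR_unbounded (Rmax N ((A / c) ^ 2))) as [n Hn].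
assert (H1 := Rmax_l N ((A / c) ^ 2)). assert (H2 := Rmax_r N ((A / c) ^ 2)).
assert (Hn0 : 0 < INR n) by lra.
assert (Hn1 : (1 <= n)%nat) by (apply (INR_lt 0) in Hn0; lia).
destruct (Hgap n Hn1) as [Y [F [HF [HD HE]]]].
exists n, Y, F. split; [lra|split; [exact HF|split; [exact HD|]]].
eapply Rle_lt_trans; [|exact HE].
apply Rmult_le_compat_r.
- apply omega_nonneg; [now apply Cper_Derive_n|apply Rdiv_lt_0_compat; lra].
- unfold Rdiv. rewrite <- Rmult_assoc. apply Rmult_le_compat_r.
  + apply Rlt_le, Rinv_0_lt_compat, pow_lt, Hn0.
  + assert (HAc : 0 < A / c) by now apply Rdiv_lt_0_compat.
    assert (Hsq : A / c <= sqrt (INR n)).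
    { rewrite <- (sqrt_pow2 (A / c)) by lra. apply sqrt_le_1_alt. lra. }
    replace A with (A / c * c) by (field; lra).
    apply Rmult_le_compat_r; lra.
Qed.
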